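(* Let $G$ be a discrete Cayley graph, $\mathcal P$ a spin model on its vertex set $V$ and $\xi$ a score function such that one of the following two conditions holds: 1. $G$ is $b$-amenable; $\mathcal P$ is a clustering spin model with clustering function $\phi$; and $\xi$ is a local score function. 2. $G$ has polynomial growth; $\mathcal P$ is an exponentially clustering spin model; $\xi$ is an exponentially quasi-local score function on $\mathcal P$ satisfying the exponential growth condition, and $(\xi,\mathcal P)$ satisfies the $p$-moment condition for all $p\ge 1$. Then the mixed moments of $\{\xi(x,\mathcal P_n)\}_{x\in\mathcal P_n}$, $1\le n\le\infty$, satisfy clustering: there exist a fast decreasing function $\tilde\phi$ and constants $\tilde C_K,\tilde c_K\in(0,\infty)$, $K\ge 1$, such that for all $1\le n\le\infty$, all $p,q\ge 1$, all distinct $z_1,\dots,z_{p+q}\in V$ and all integers $k_1,\dots,k_{p+q}\ge 1$, setting $K=\sum_{i=1}^{p+q}k_i$ and $s=d(\{z_1,\dots,z_p\},\{z_{p+1},\dots,z_{p+q}\})$, $$\bigl|m_n^{k_1,\dots,k_{p+q}}(z_1,\dots,z_{p+q})-m_n^{k_1,\dots,k_p}(z_1,\dots,z_p)\,m_n^{k_{p+1},\dots,k_{p+q}}(z_{p+1},\dots,z_{p+q})\bigr|\le \tilde C_K\,\tilde\phi(\tilde c_K s).$$ Further, under condition 1, if $\phi$ is summable in $G$, then so is $\tilde\phi$.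
   Context: **Cayley graphs.** $(V,+)$ is a countably infinite group (not necessarily commutative) with identity $O$, generated by a finite symmetric set $S$ ($h\in S\iff -h\in S$) with $O\notin S$. The discrete Cayley graph $G=(V,E)$ has $(g_1,g_2)\in E$ iff $-g_1+g_2\in S$. $d$ is the graph distance, $|x|=d(O,x)$, so $d(x,y)=|-x+y|$; $d(A,B)=\min_{x\in A,y\in B}d(x,y)$. $W_r(x)=\{y:d(x,y)\le r\}$, $W_r=W_r(O)$, $W_\infty=V$, $w_n=|W_n|$. $\partial A=\{x\in A:\exists y\notin A,\ (x,y)\in E\}$. $G$ is $b$-amenable if $|\partial W_n|/|W_n|\to0$ as $n\to\infty$; $G$ has polynomial growth if $|W_n|=O(n^{d_2})$ for some $d_2>0$. **Spin models.** $\mathcal N=\{0,1\}^V$; $\mu\in\mathcal N$ is identified with the subset $\{x:\mu_x=1\}$ of $V$. A spin model is an $\mathcal N$-valued random variable $\mathcal P$; $\mathcal P_n=\mathcal P\cap W_n$, $\mathcal P_\infty=\mathcal P$. $\mathcal P$ is stationary if $y+\mathcal P\stackrel d=\mathcal P$ for all $y\in V$, non-degenerate if $\mathbb P(O\in\mathcal P)\in(0,1)$. A function $\phi:[0,\infty)\to[0,\infty)$ is fast decreasing if $\phi\le1$, $\phi$ is decreasing and $\lim_{s\to\infty}s^m\phi(s)=0$ for all $m\ge1$. A stationary non-degenerate $\mathcal P$ is a clustering spin model if there are constants $C_k,c_k\in(0,\infty)$ ($C_k$ non-decreasing, $c_k$ non-increasing in $k$) and a fast decreasing $\phi$ (the clustering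 function) such that for all $p,q\ge1$ and distinct $x_1,\dots,x_{p+q}\in V$, $$|\mathbb P(\{x_1,\dots,x_{p+q}\}\subset\mathcal P)-\mathbb P(\{x_1,\dots,x_p\}\subset\mathcal P)\mathbb P(\{x_{p+1},\dots,x_{p+q}\}\subset\mathcal P)|\le C_{p+q}\phi(c_{p+q}s),$$ $s=d(\{x_1,\dots,x_p\},\{x_{p+1},\dots,x_{p+q}\})$. It is exponentially clustering if moreover $c_k\ge c>0$ for all $k$, $C_k=O(k^{ak})$ for some $a\in[0,1)$ and $\limsup_{t\to\infty}\log\phi(t)/t^b<0$ for some $b\in(0,\infty)$. A fast decreasing $\phi$ is summable in $G$ if $\sum_{x\in V}\phi^{1/p}(c|x|)<\infty$ for all $c>0$, $p\ge1$. **Score functions.** A score function is a measurable $\xi:V\times\mathcal N\to\mathbb R$ that is translation-invariant, $\xi(y+x,y+\mu)=\xi(x,\mu)$, with the convention $\xi(x,\mu)=0$ if $x\notin\mu$. It is local if there is $r>0$ such that $\xi(O,\mu)$ depends only on $\mu\cap W_r$ for every $\mu$. The radius of stabilisation is $R(O,\mu)=\inf\{r>0,\ r\in\mathbb N:\xi(O,\mu)=\xi(O,\mu')\ \forall\mu'\in\mathcal N\text{ with }\mu'\cap W_r=\mu\cap W_r\}$ and $R(x,\mu)=R(O,-x+\mu)$. $\xi$ is exponentially quasi-local on $\mathcal P$ if there are $A>0$ and a function $\varphi(t)\downarrow0$ with $\sup_{1\le n\le\infty}\sup_{x\in W_n}\mathbb P(R(x,\mathcal P_n)\ge t)\le A\varphi(t)$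 for all $t$ and $\limsup_{t\to\infty}\log\varphi(t)/t^c<0$ for some $c\in(0,\infty)$. Exponential growth condition: for some $\kappa\in[0,\infty)$ and constant $c_*<\infty$, $|\xi(O,\mu\cap W_t)|\le e^{c_*t^\kappa}$ for all $t>0$, $\mu\in\mathcal N$. $p$-moment condition: $\sup_{1\le n\le\infty}\sup_{x\in W_n}\mathbb E(\max\{|\xi(x,\mathcal P_n)|,1\}^p)<\infty$. **Mixed moments.** For distinct $x_1,\dots,x_p$ and $k_i\ge1$, $m_n^{k_1,\dots,k_p}(x_1,\dots,x_p)=\mathbb E\bigl(\prod_{i=1}^p\xi(x_i,\mathcal P_n)^{k_i}\bigr)$, $1\le n\le\infty$. *)

(* Defs.v *)
From HB Require Import structures.
From mathcomp Require Import all_boot all_order all_algebra.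
From mathcomp Require Import finmap.
From mathcomp Require Import all_classical all_reals all_analysis.

Set Implicit Arguments.
Unset Strict Implicit.
Unset Printing Implicit Defensive.

Import Order.TTheory GRing.Theory Num.Theory.
Import numFieldNormedType.Exports.

Local Open Scope classical_set_scope.
Local Open Scope ring_scope.

(* Groups are written multiplicatively: the informal -x + y is x^-1 * y.      *)

(* V with its discrete sigma-algebra *)
Definition discrete (V : groupType) : Type := V.

HB.instance Definition _ (V : groupType) := Choice.on (discrete V).
HB.instance Definition _ (V : groupType) :=
  isPointed.Build (discrete V) (1%g : V).
HB.instance Definition _ (V : groupType) :=
  @isMeasurable.Build default_measure_display (discrete V)
    (@discrete_measurable (discrete V)) (@discrete_measurable0 (discrete V))
    (@discrete_measurableC (discrete V)) (@discrete_measurableU (discrete V)).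

(* {0,1}^V, seen as the sets of points with spin 1, with the product          *)
(* sigma-algebra: the one generated by the one-site events {mu_x = 1}.        *)
Definition site_events (V : groupType) : set (set (set V)) :=
  range (fun x : V => [set mu : set V | mu x]).

Definition spins (V : groupType) := g_sigma_algebraType (@site_events V).

(* minimum of a nonempty set of natural numbers *)
Definition natmin (A : set nat) : nat := xget 0%N [set m | A m /\ lbound A m].

Section cayley_graph.
Context {R : realType} {V : groupType}.
Variable S : set V.

Definition generates : Prop :=
  forall H : {pred V}, group_closed H -> (forall h, S h -> h \in H) ->
  forall x, x \in H.

Definition cayley_data : Prop :=
  [/\ ([set: V] #= [set: nat])%card, finite_set S,
      forall h, S h <-> S h^-1%g, ~ S 1%g & generates].

Definition edge : rel V := fun g h => (g^-1 * h)%g \in S.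

Definition dist (x y : V) : nat :=
  natmin [set size s | s in [set s | path edge x s /\ last x s = y]].

Definition norm (x : V) : nat := dist 1%g x.

Definition setdist (A B : set V) : nat :=
  natmin [set dist x y | x in A & y in B].

(* The radius is extended real, so that W_oo = V. *)
Definition window (r : \bar R) (x : V) : set V :=
  [set y | ((dist x y)%:R%:E <= r)%E].

(* the range 1 <= n <= oo of the window index *)
Definition window_index : set (\bar R) :=
  [set n | n = +oo%E \/ exists2 k : nat, (1 <= k)%N & n = k%:R%:E].

Definition boundary (A : set V) : set V :=
  [set x | A x /\ exists2 y, ~ A y & edge x y].

Definition card_window (n : nat) : R :=
  #|` fset_set (window n%:R%:E 1%g)|%:R.

Definition card_boundary (n : nat) : R :=
  #|` fset_set (boundary (window n%:R%:E 1%g))|%:R.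

Definition b_amenable : Prop :=
  (fun n => card_boundary n / card_window n) @ \oo --> (0 : R).

Definition polynomial_growth : Prop :=
  exists2 d : R, 0 < d & card_window =O_\oo (fun n => n%:R `^ d).

End cayley_graph.

Section decay.
Context {R : realType}.
Implicit Type phi : R -> R.

(* Only the values of phi on [0, +oo[ are relevant; decreasing is meant in    *)
(* the weak sense.                                                            *)
Definition fast_decreasing phi : Prop :=
  [/\ forall s : R, 0 <= s -> 0 <= phi s <= 1,
      forall s t : R, 0 <= s -> s <= t -> phi t <= phi s &
      forall m : nat, (1 <= m)%N -> s ^+ m * phi s @[s --> +oo] --> 0].

(* limsup_(t -> oo) (log phi(t)) / t^b < 0; lne is used because log 0 = -oo,  *)
(* whereas ln 0 = 0.                                                          *)
Definition stretched_exp_decay phi (b : R) : Prop :=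
  (limf_esup (fun t : R => lne (phi t)%:E * ((t `^ b)^-1)%:E) +oo%R < 0)%E.

Definition summable_in {V : groupType} (S : set V) phi : Prop :=
  forall c p : R, 0 < c -> 1 <= p ->
  (\esum_(x in [set: V]) (phi (c * (norm S x)%:R) `^ p^-1)%:E < +oo)%E.

End decay.

Definition translate {V : groupType} (y : V) (mu : set V) : set V :=
  [set (y * x)%g | x in mu].

Section spin_models.
Context {R : realType} {V : groupType}.
Variable S : set V.
Context {d : measure_display} {Omega : measurableType d}
  {Pr : probability Omega R}.
Variable X : {RV Pr >-> spins V}.

Definition stationary : Prop :=
  forall (y : V) (A : set (spins V)), measurable A ->
  pushforward Pr (translate y \o X : Omega -> spins V) A = distribution Pr X A.

Definition nondegenerate : Prop :=
  (0 < Pr [set w | X w 1%g] < 1)%E.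

Definition prob_contains (A : set V) : \bar R := Pr [set w | A `<=` X w].

Definition clustering_with (C c : nat -> R) (phi : R -> R) : Prop :=
  [/\ forall k, 0 < C k, {homo C : k l / (k <= l)%N >-> k <= l},
      forall k, 0 < c k, {homo c : k l / (k <= l)%N >-> l <= k} &
      forall (p q : nat) (x : 'I_(p + q) -> V),
        (1 <= p)%N -> (1 <= q)%N -> injective x ->
        let A := range (x \o lshift q) in
        let B := range (x \o @rshift p q) in
        (`| prob_contains (range x) - prob_contains A * prob_contains B |
          <= (C (p + q)%N * phi (c (p + q)%N * (setdist S A B)%:R))%:E)%E].

Definition clustering_spin_model (phi : R -> R) : Prop :=
  [/\ stationary, nondegenerate, fast_decreasing phi &
      exists C c, clustering_with C c phi].

Definition exp_clustering_spin_model : Prop :=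
  [/\ stationary, nondegenerate &
      exists phi C c,
        [/\ fast_decreasing phi, clustering_with C c phi,
            exists2 c0 : R, 0 < c0 & forall k, c0 <= c k,
            exists a : R, [/\ 0 <= a, a < 1 &
              C =O_\oo (fun k => k%:R `^ (a * k%:R))] &
            exists2 b : R, 0 < b & stretched_exp_decay phi b]].

(* P_n, with P_oo = P *)
Definition in_window (n : \bar R) (w : Omega) : set V :=
  X w `&` window S n 1%g.

Variable xi : V -> set V -> R.

Definition score_function : Prop :=
  [/\ measurable_fun [set: discrete V * spins V] (fun u => xi u.1 u.2),
      forall y x mu, xi (y * x)%g (translate y mu) = xi x mu &
      forall x (mu : set V), ~ mu x -> xi x mu = 0].

Definition determined_in (r : R) (mu : set V) : Prop :=
  forall mu' : set V,
    mu' `&` window S r%:E 1%g = mu `&` window S r%:E 1%g ->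
    xi 1%g mu = xi 1%g mu'.

Definition local : Prop :=
  exists2 r : R, 0 < r & forall mu, determined_in r mu.

(* +oo when no radius stabilises *)
Definition stab_radius (x : V) (mu : set V) : \bar R :=
  ereal_inf [set r%:R%:E | r in
    [set r : nat | (0 < r)%N /\ determined_in r%:R (translate x^-1%g mu)]].

Definition exp_quasi_local : Prop :=
  exists (A : R) (phi : R -> R),
    [/\ 0 < A,
        forall s t : R, 0 <= s -> s <= t -> phi t <= phi s,
        phi t @[t --> +oo] --> 0,
        forall t : R, 0 <= t ->
          (ereal_sup [set ereal_sup
             [set Pr [set w | (t%:E <= stab_radius x (in_window n w))%E]
               | x in window S n 1%g] | n in window_index] <= (A * phi t)%:E)%E &
        exists2 c : R, 0 < c & stretched_exp_decay phi c].

Definition exp_growth : Prop :=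
  exists2 kappa : R, 0 <= kappa & exists c : R,
    forall (t : R) (mu : set V), 0 < t ->
    `| xi 1%g (mu `&` window S t%:E 1%g) | <= expR (c * t `^ kappa).

Definition moment_condition (p : R) : Prop :=
  (ereal_sup [set ereal_sup
     [set 'E_Pr[(fun w => Num.max `|xi x (in_window n w)| 1 `^ p)%R]
       | x in window S n 1%g] | n in window_index] < +oo)%E.

Definition mixed_moment (n : \bar R) (p : nat) (x : 'I_p -> V)
    (k : 'I_p -> nat) : \bar R :=
  ('E_Pr[(fun w => \prod_(i < p) xi (x i) (in_window n w) ^+ k i)%R])%E.

Definition mixed_moments_cluster (phi : R -> R) : Prop :=
  fast_decreasing phi /\
  exists C c : nat -> R,
    (forall K, (1 <= K)%N -> 0 < C K /\ 0 < c K) /\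
    forall (n : \bar R) (p q : nat) (z : 'I_(p + q) -> V)
        (k : 'I_(p + q) -> nat),
      window_index n -> (1 <= p)%N -> (1 <= q)%N -> injective z ->
      (forall i, (1 <= k i)%N) ->
      let K := (\sum_(i < p + q) k i)%N in
      let s := setdist S (range (z \o lshift q)) (range (z \o @rshift p q)) in
      (`| mixed_moment n z k
          - mixed_moment n (z \o lshift q) (k \o lshift q)
            * mixed_moment n (z \o @rshift p q) (k \o @rshift p q) |
        <= (C K * phi (c K * s%:R))%:E)%E.

Definition condition1 (phi : R -> R) : Prop :=
  [/\ b_amenable (R := R) S, clustering_spin_model phi & local].

Definition condition2 : Prop :=
  [/\ polynomial_growth (R := R) S, exp_clustering_spin_model,
      exp_quasi_local, exp_growth & forall p : R, 1 <= p -> moment_condition p].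

End spin_models.

(* Main.v *)
Require Import Defs.
From mathcomp Require Import all_boot all_order all_algebra.
From mathcomp Require Import finmap.
From mathcomp Require Import all_classical all_reals all_analysis.
From mathcomp Require Import measurable_realfun.
From mathcomp Require Import zify ring lra.

(* A score that is stable at radius [t] is a function of the spins in a ball of
   radius [t]. A function [F] of finitely many spins is affine in each of them,
   so peeling the spins off one at a time writes it in terms of the monomials
   1{K is contained in P} at a cost of a factor 3 per spin; hence clustering of
   P bounds the covariance of two functions of spins in disjoint balls by
   3^N |F| |G| C_N phi(c_N (s - 2t)), where N counts the spins involved.

   For a local score this is the theorem. In the quasi-local case a score is
   replaced by 0 where it is not stable at radius [t]; moments and the tail of
   the stabilisation radius make the error a stretched exponential in [t].
   Taking [t] to be a small power of [s], the exponent t^(kappa + 2a) paid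
   through growth and ball volume t^a is at most s^(b/2), which is beaten by the
   clustering rate s^b. *)

Set Implicit Arguments.
Unset Strict Implicit.
Unset Printing Implicit Defensive.

Import Order.TTheory GRing.Theory Num.Theory.
Import numFieldNormedType.Exports.

Local Open Scope classical_set_scope.
Local Open Scope ring_scope.

(** Whether a score is stable at radius t is itself decided by the spins in the ball of radius t.
    This is what allows unstable scores to be set to 0 without losing a function of finitely many
    spins. The window W_n is intersected inside such functions, so they depend on the spins of P in
    balls that do not vary with n, and clustering of P gives bounds uniform in n. Since every k_i is
    at least 1, there are at most K points, so N can be K times the ball volume and the constants
    depend on K only. In the quasi-local case the obstacle is that t, hence N, grows with s, so C_N
    is no longer a constant. Up to a factor it is at most exp(N^2), and N of order t^a produces the
    2a in the exponent; c_N stays above a fixed c0. The truncation error is controlled by the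
    pointwise inequality |f| 1_U <= eps f^2 + eps^-1 1_U on the unstable event U, where eps is the
    square root of the stretched exponential in the tail bound, so that both terms have the order of
    eps. *)

Lemma natminP (A : set nat) n : A n -> A (natmin A) /\ (natmin A <= n)%N.
Proof.
move=> An; have exA : exists m, `[< A m >] by exists n; apply/asboolP.
have [m /asboolP Am mmin] := ex_minnP exA.
have Bm : [set m | A m /\ lbound A m] m.
  by split=> // k Ak; apply: mmin; apply/asboolP.
have [AN lbN] := xgetPex 0%N (ex_intro _ m Bm).
by split=> //; apply: lbN.
Qed.

(** * Graph distance, finite balls and windows in the Cayley graph *)

Section cayley.
Variables (V : groupType) (S : set V).
Hypothesis hS : cayley_data S.

Let edge_sym x y : edge S x y = edge S y x.
Proof.
have [_ _ Ssym _ _] := hS.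
by apply/idP/idP; rewrite /edge !inE => /Ssym; rewrite invgM invgK.
Qed.

Let edge_mull g x y : edge S (g * x)%g (g * y)%g = edge S x y.
Proof. by rewrite /edge invgM -mulgA mulKg. Qed.

Lemma path_edge_rev x s : path (edge S) x s ->
  exists s', [/\ path (edge S) (last x s) s', last (last x s) s' = x &
    size s' = size s].
Proof.
move=> ps; exists (rev (belast x s)); split.
- rewrite rev_path; apply: sub_path ps => u v.
  by rewrite edge_sym.
- by case: s {ps} => //= a s; rewrite rev_cons last_rcons.
- by rewrite size_rev size_belast.
Qed.

(** The elements u such that every g is joined to g * u form a subgroup containing S, hence the
    whole group. Quantifying over g makes concatenation of paths immediate. *)
Lemma path_edge_ex x y : exists s, path (edge S) x s /\ last x s = y.
Proof.
have [_ _ _ _ gen] := hS.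
pose H : {pred V} := [pred u | `[< forall g, exists s,
  path (edge S) g s /\ last g s = (g * u)%g >]].
have HH : group_closed H.
  split.
    by apply/asboolP => g; exists [::]; rewrite /= mulg1.
  move=> u v /asboolP Hu /asboolP Hv; apply/asboolP => g.
  have [s [ps ls]] := Hu g.
  have [s' [ps' ls']] := Hv (g * (u / v))%g.
  (* From g walk to g * u, which is also the end of a path from g * (u / v) along v; the reversed
     path leads on to g * (u / v). *)
  have [s'' [ps'' ls'' _]] := path_edge_rev ps'.
  exists (s ++ s''); rewrite cat_path last_cat ps ls.
  have E : (g * u)%g = last (g * (u / v))%g s'.
    by rewrite ls' -mulgA divgK.
  by rewrite E ps'' ls''.
have := gen H HH _ (x^-1 * y)%g.
case/(_ _)/asboolP/(_ x) => [h Sh|s]; last by rewrite mulVKg => ?; exists s.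
apply/asboolP => g; exists [:: (g * h)%g]; rewrite /= andbT; split=> //.
by rewrite /edge mulKg inE.
Qed.

Lemma dist_path x y : exists s,
  [/\ path (edge S) x s, last x s = y & size s = dist S x y].
Proof.
have [s0 P0] := path_edge_ex x y.
have [[s [ps ls] E] _] := natminP (ex_intro2 _ _ s0 P0 erefl :
  [set size s | s in [set s | path (edge S) x s /\ last x s = y]] (size s0)).
by exists s; split.
Qed.

Lemma dist_le_size x s : path (edge S) x s -> (dist S x (last x s) <= size s)%N.
Proof. by move=> ps; apply: (natminP _).2; exists s. Qed.

Lemma dist_triangle x y z : (dist S x z <= dist S x y + dist S y z)%N.
Proof.
have [s [ps ls <-]] := dist_path x y; have [s' [ps' ls' <-]] := dist_path y z.
rewrite -size_cat -ls' -ls -last_cat; apply: dist_le_size.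
by rewrite cat_path ps ls.
Qed.

Lemma dist_sym x y : dist S x y = dist S y x.
Proof.
suff le a b : (dist S a b <= dist S b a)%N by apply/eqP; rewrite eqn_leq !le.
have [s [ps ls <-]] := dist_path b a.
have [s' [ps' ls' <-]] := path_edge_rev ps.
by have := dist_le_size ps'; rewrite ls' ls.
Qed.

Lemma dist_mull g x y : dist S (g * x)%g (g * y)%g = dist S x y.
Proof.
suff le h a b : (dist S (h * a)%g (h * b)%g <= dist S a b)%N.
  apply/eqP; rewrite eqn_leq le /=.
  by rewrite -{1}(mulKg g x) -{1}(mulKg g y).
have [s [ps <- <-]] := dist_path a b.
pose f y := (h * y)%g.
rewrite -[(h * last a s)%g]/(f _) -(last_map f) -(size_map f).
apply: dist_le_size; rewrite path_map; apply: sub_path ps => u v.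
by rewrite /= edge_mull.
Qed.

Lemma finite_ball n : finite_set [set y | (dist S 1%g y <= n)%N].
Proof.
have [_ finS _ _ _] := hS.
elim: n => [|n IH].
  apply: (@sub_finite_set _ _ [set 1%g]) => [y /=|//].
  rewrite leqn0 => /eqP d0; have [s [_ ls]] := dist_path 1%g y.
  by rewrite d0 => /size0nil s0; rewrite -ls s0.
pose B := [set y | (dist S 1%g y <= n)%N].
apply: (@sub_finite_set _ _ (B `|` [set (u * h)%g | u in B & h in S])).
  move=> y /=; have [s [ps <- <-]] := dist_path 1%g y.
  case/lastP: s ps => [|s u]; first by move=> _ _; left; rewrite /B/=; exact:
    (leq_trans (dist_le_size (s := [::]) isT)).
  rewrite rcons_path size_rcons last_rcons ltnS => /andP[ps eu] sn; right.
  exists (last 1%g s); first exact: (leq_trans (dist_le_size ps)).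
  by exists ((last 1 s)^-1 * u)%g; [move: eu; rewrite /edge inE | rewrite
    mulVKg].
by rewrite finite_setU; split=> //; apply: finite_image2.
Qed.

Lemma setdist_attained (A B : set V) : A !=set0 -> B !=set0 ->
  exists x y, [/\ A x, B y & setdist S A B = dist S x y].
Proof.
move=> [a Aa] [b Bb].
have [[x Ax [y By E]] _] := natminP (A := [set dist S x y | x in A & y in B])
  (ex_intro2 _ _ a Aa (ex_intro2 _ _ b Bb erefl)).
by exists x, y; split.
Qed.

Lemma setdist_le (A B : set V) x y : A x -> B y -> (setdist S A B <= dist S x
  y)%N.
Proof. by move=> Ax By; apply: (natminP _).2; exists x => //; exists y. Qed.

(** Every ball is a translate of one enumeration of the ball around the identity, so all balls of
    radius t have the same length as sequences. *)
Definition ball_seq (t : nat) (x : V) : seq V :=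
  [seq (x * v)%g | v <- fset_set [set y | (dist S 1%g y <= t)%N]].

Lemma mem_ball_seq t x y : (y \in ball_seq t x) = (dist S x y <= t)%N.
Proof.
apply/mapP/idP => [[v]|d]; last first.
  exists (x^-1 * y)%g; last by rewrite mulVKg.
  by rewrite in_fset_set ?inE /=; [rewrite -(dist_mull x) mulg1 mulVKg|
    exact: finite_ball].
rewrite in_fset_set ?inE /=; last exact: finite_ball.
by move=> d ->; rewrite -{1}(mulg1 x) dist_mull.
Qed.

Lemma size_ball_seq t x : size (ball_seq t x) = size (ball_seq t 1%g).
Proof. by rewrite !size_map. Qed.

Variable R : realType.

Lemma card_windowE t : @card_window R V S t = (size (ball_seq t 1%g))%:R.
Proof.
rewrite /card_window size_map; congr (#|` fset_set _|%:R).
by apply/seteqP; split=> y; rewrite /window /= lee_fin ler_nat.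
Qed.

Lemma window_natE (t : nat) x :
  window S (t%:R%:E : \bar R) x = [set y | (dist S x y <= t)%N].
Proof. by apply/seteqP; split=> y; rewrite /window /= lee_fin ler_nat. Qed.

End cayley.

(** * Functions of finitely many spins and their monomial expansion *)

Section cylinder.
Variables (V : groupType) (R : realType).
Implicit Types (A K : seq V) (F G : set V -> R) (mu nu : set V).

(** The codomain is free so that the notion covers propositions such as [stable] as well as real
    scores. *)
Definition depends_on {U : Type} A (F : set V -> U) : Prop :=
  forall mu nu, (forall x, x \in A -> mu x <-> nu x) -> F mu = F nu.

Definition contains K mu : R := `[< forall x, x \in K -> mu x >]%:R.

Lemma contains_nil mu : contains [::] mu = 1.
Proof. by rewrite /contains asboolT. Qed.

Lemma contains_cons a K mu : contains (a :: K) mu = `[< mu a >]%:R * contains K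
  mu.
Proof.
rewrite /contains -natrM mulnb; congr (_%:R); congr nat_of_bool.
apply/asboolP/andP => [h|[/asboolP ha /asboolP hK] x].
  by split; apply/asboolP; [|move=> x xK]; apply: h;
    rewrite inE ?eqxx ?xK ?orbT.
by rewrite inE => /orP[/eqP->//|/hK].
Qed.

Lemma depends_on_contains K : depends_on K (contains K).
Proof.
move=> mu nu h; congr (_%:R); congr nat_of_bool; apply: asbool_equiv_eq.
by split=> H x xK; apply/h => //; apply: H.
Qed.

Lemma depends_on_sub {U : Type} A A' (F : set V -> U) :
  {subset A <= A'} -> depends_on A F -> depends_on A' F.
Proof. by move=> sAA' hF mu nu h; apply: hF => x /sAA'; apply: h. Qed.

Lemma depends_on_op2 {U1 U2 U3 : Type} (op : U1 -> U2 -> U3) A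
    (F1 : set V -> U1) (F2 : set V -> U2) :
  depends_on A F1 -> depends_on A F2 ->
  depends_on A (fun mu => op (F1 mu) (F2 mu)).
Proof. by move=> h1 h2 mu nu e; rewrite (h1 mu nu) // (h2 mu nu). Qed.

Lemma depends_on_nil {U : Type} (F : set V -> U) mu :
  depends_on [::] F -> F mu = F set0.
Proof. by apply. Qed.

Lemma depends_on_del {U : Type} a A (F : set V -> U) : depends_on (a :: A) F ->
  depends_on A (fun mu => F (mu `\ a)).
Proof.
move=> h mu nu e; apply: h => x; rewrite inE.
case/orP => [/eqP->|xA]; split=> -[m n]; split=> //.
- by case: n.
- by case: n.
- exact/e.
- exact/e.
Qed.

Lemma depends_on_ins {U : Type} a A (F : set V -> U) : depends_on (a :: A) F ->
  depends_on A (fun mu => F (a |` mu)).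
Proof.
move=> h mu nu e; apply: h => x; rewrite inE.
case/orP => [/eqP->|xA]; split=> -[m|m]; by [left|right; apply/e].
Qed.

(** F is affine in the spin at a, with its discrete derivative as slope; neither the intercept nor
    the slope sees that spin. *)
Lemma spin_decomposition F a mu :
  F mu = F (mu `\ a) + `[< mu a >]%:R * (F (a |` mu) - F (mu `\ a)).
Proof.
case: (asboolP (mu a)) => h.
  rewrite mul1r addrC subrK; congr F; apply/seteqP; split=> x; first by right.
  by case=> [->|].
rewrite mul0r addr0; congr F; apply/seteqP; split=> x; last by case.
by move=> mx; split=> // e; apply: h; rewrite -e.
Qed.

Lemma cylinder_bounded A F : depends_on A F ->
  exists M, forall mu, `|F mu| <= M.
Proof.
elim: A F => [|a A IH] F hF.
  by exists `|F set0| => mu; rewrite (depends_on_nil mu hF).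
have [M0 h0] := IH _ (depends_on_del hF).
have [M1 h1] := IH _ (depends_on_ins hF).
exists (M0 + (M1 + M0)) => mu; rewrite (spin_decomposition F a).
rewrite (le_trans (ler_normD _ _))// lerD// normrM.
rewrite (le_trans (y := 1 * `|F (a |` mu) - F (mu `\ a)|))//.
  by rewrite ler_wpM2r// normr_nat lern1 leq_b1.
by rewrite mul1r (le_trans (ler_normB _ _))// lerD.
Qed.

Lemma cylinder_measurable d (T : measurableType d) (X : T -> set V) A F :
  (forall x, measurable [set w | X w x]) -> depends_on A F ->
  measurable_fun setT (fun w => F (X w)).
Proof.
move=> mX; elim: A F => [|a A IH] F hF.
  under eq_fun do rewrite (depends_on_nil _ hF); exact: measurable_cst.
rewrite (_ : (fun w => _) = (fun w => F (X w `\ a) +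
    \1_[set w | X w a] w * (F (a |` X w) - F (X w `\ a)))); last first.
  apply/funext => w; rewrite [LHS](spin_decomposition F a) indicE.
  by congr (_ + _%:R * _); congr nat_of_bool; rewrite in_setE.
apply: measurable_funD; first exact: (IH _ (depends_on_del hF)).
apply: measurable_funM; first exact: measurable_indic.
by apply: measurable_funB; [exact: (IH _ (depends_on_ins hF))
  | exact: (IH _ (depends_on_del hF))].
Qed.

(** Peeling off one spin replaces F, bounded by M, by an intercept bounded by M and a slope bounded
    by 2 M; this is the factor 3 = 1 + 2. Linearity of L is assumed on cylinder functions only,
    where integrability in the application is automatic. *)
Lemma cylinder_linear_bound (L : (set V -> R) -> R) (A : seq V) (D M : R) F :
  (forall B F1 F2, depends_on B F1 -> depends_on B F2 ->
    L (fun mu => F1 mu + F2 mu) = L F1 + L F2) ->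
  (forall B F1 c, depends_on B F1 ->
    L (fun mu => c * F1 mu) = c * L F1) ->
  (forall K : seq V, {subset K <= A} -> `|L (contains K)| <= D) ->
  depends_on A F -> (forall mu, `|F mu| <= M) ->
  `|L F| <= 3 ^+ size A * M * D.
Proof.
move=> LD LZ LK.
(* [A'] lists the spins still to be peeled off, and [contains K] is the monomial collected from
   those already peeled. *)
suff H A' : forall K F M, {subset A' ++ K <= A} -> depends_on A' F ->
    (forall mu, `|F mu| <= M) ->
    `|L (fun mu => F mu * contains K mu)| <= 3 ^+ size A' * M * D.
  move=> hF FM; have := H A [::] F M _ hF FM.
  rewrite cats0 (_ : (fun mu => _) = F); first by apply.
  by apply/funext => mu; rewrite contains_nil mulr1.
have D0 : 0 <= D by apply: le_trans (LK [::] _).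
elim: A' => [|a A' IH] K {}F {}M sA hF FM.
  rewrite expr0 mul1r (_ : (fun mu => _) = (fun mu => F set0 * contains K mu)).
    rewrite (LZ K); last exact: depends_on_contains.
    rewrite normrM ler_pM//; exact: LK.
  by apply/funext => mu; rewrite (depends_on_nil mu hF).
have sA1 : {subset A' ++ K <= A}.
  by move=> x xA; apply: sA; rewrite inE xA orbT.
have sA2 : {subset A' ++ a :: K <= A}.
  by move=> x; rewrite mem_cat inE orbCA -mem_cat => xA; apply: sA; rewrite inE.
have d0 := depends_on_del hF; have d1 := depends_on_ins hF.
have d2 := depends_on_op2 (fun u v => u - v) d1 d0.
have b0 := IH K _ M sA1 d0 (fun mu => FM _).
have b2 := IH (a :: K) _ (M + M) sA2 d2
  (fun mu => le_trans (ler_normB _ _) (lerD (FM _) (FM _))).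
set F0 := (X in L X) in b0; set F2 := (X in L X) in b2.
rewrite (_ : (fun mu => F mu * _) = (fun mu => F0 mu + F2 mu)); last first.
  apply/funext => mu; rewrite (spin_decomposition F a) /F0 /F2 contains_cons.
  by ring.
rewrite (LD (A' ++ a :: K)).
- apply: le_trans (ler_normD _ _) _; apply: le_trans (lerD b0 b2) _.
  by rewrite exprS; lra.
- apply: depends_on_op2.
    by apply: depends_on_sub d0 => x xA; rewrite mem_cat xA.
  apply: depends_on_sub (@depends_on_contains K) => x xK.
  by rewrite mem_cat inE xK !orbT.
- apply: depends_on_op2.
    by apply: depends_on_sub d2 => x xA; rewrite mem_cat xA.
  apply: depends_on_sub (@depends_on_contains (a :: K)) => x xK.
  by rewrite mem_cat xK !orbT.
Qed.

End cylinder.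

(** * Covariance of cylinder functions of a random configuration *)

Section covariance.
Variables (R : realType) (V : groupType) (d : measure_display)
  (T : measurableType d) (Pr : probability T R).

Definition mean (f : T -> R) : R := (\int[Pr]_w f w)%R.
Definition integ (f : T -> R) : Prop := Pr.-integrable setT (EFin \o f).

Lemma integ_bounded (f : T -> R) M : measurable_fun setT f ->
  (forall w, `|f w| <= M) -> integ f.
Proof.
move=> mf fM; apply: measurable_bounded_integrable => //.
  by rewrite (le_lt_trans (probability_le1 _ _))// ltry.
exists M; split; first exact: num_real.
by move=> x Mx w _; apply: le_trans (fM w) (ltW Mx).
Qed.

Lemma meanD (f g : T -> R) : integ f -> integ g ->
  mean (fun w => f w + g w) = mean f + mean g.
Proof. by move=> hf hg; rewrite /mean RintegralD. Qed.

Lemma meanB (f g : T -> R) : integ f -> integ g ->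
  mean (fun w => f w - g w) = mean f - mean g.
Proof. by move=> hf hg; rewrite /mean RintegralB. Qed.

Lemma meanZ (f : T -> R) c : integ f -> mean (fun w => c * f w) = c * mean f.
Proof. by move=> hf; rewrite /mean RintegralZl. Qed.

Lemma mean_cst c : mean (fun=> c) = c.
Proof. rewrite /mean Rintegral_cst// -[RHS]mulr1; congr (c * _).
exact: (congr1 fine (@probability_setT _ _ _ Pr)).
Qed.

Lemma mean_le (f g : T -> R) : integ f -> integ g -> (forall w, f w <= g w) ->
  mean f <= mean g.
Proof. by move=> hf hg fg; apply: le_Rintegral. Qed.

Lemma mean_norm_le (f g : T -> R) : integ f -> integ g ->
  (forall w, `|f w| <= g w) -> `|mean f| <= mean g.
Proof.
move=> hf hg fg; apply: le_trans (le_normr_Rintegral _ _) _ => //.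
by apply: mean_le => //; apply: integrable_norm.
Qed.

Variable X : T -> set V.
Hypothesis mX : forall x, measurable [set w | X w x].

Lemma integ_cylinder A (F : set V -> R) : depends_on A F ->
  integ (fun w => F (X w)).
Proof.
move=> hF; have [M FM] := cylinder_bounded hF.
by apply: integ_bounded (cylinder_measurable mX hF) _ => w; apply: FM.
Qed.

Definition cov (F G : set V -> R) : R :=
  mean (fun w => F (X w) * G (X w)) - mean (fun w => F (X w)) * mean (fun w =>
    G (X w)).

Lemma covC F G : cov F G = cov G F.
Proof.
rewrite /cov [mean (fun w => F _) * _]mulrC; congr (mean _ - _).
by apply/funext => w; rewrite mulrC.
Qed.

Lemma covDl A B F1 F2 G : depends_on A F1 -> depends_on A F2 -> depends_on B G
  ->
  cov (fun mu => F1 mu + F2 mu) G = cov F1 G + cov F2 G.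
Proof.
move=> h1 h2 hG.
have sA : {subset A <= A ++ B} by move=> x; rewrite mem_cat => ->.
have sB : {subset B <= A ++ B} by move=> x; rewrite mem_cat orbC => ->.
have iG F : depends_on A F -> integ (fun w => F (X w) * G (X w)).
  move=> hF; apply: (integ_cylinder (A := A ++ B) (F := fun mu => F mu * G mu)).
  exact: depends_on_op2 (depends_on_sub sA hF) (depends_on_sub sB hG).
rewrite /cov; under [X in mean X]eq_fun do rewrite mulrDl.
rewrite !meanD; first (by ring); first [exact: iG | exact: integ_cylinder h1
  | exact: integ_cylinder h2].
Qed.

Lemma covZl A B F G c : depends_on A F -> depends_on B G ->
  cov (fun mu => c * F mu) G = c * cov F G.
Proof.
move=> hF hG.
have sA : {subset A <= A ++ B} by move=> x; rewrite mem_cat => ->.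
have sB : {subset B <= A ++ B} by move=> x; rewrite mem_cat orbC => ->.
have iG : integ (fun w => F (X w) * G (X w)).
  apply: (integ_cylinder (A := A ++ B) (F := fun mu => F mu * G mu)).
  exact: depends_on_op2 (depends_on_sub sA hF) (depends_on_sub sB hG).
rewrite /cov; under [X in mean X]eq_fun do rewrite -mulrA.
rewrite !meanZ; first (by ring); first [exact: iG | exact: integ_cylinder hF].
Qed.

(** Covariance is bilinear on cylinder functions, so the monomial bound applies twice: in G against
    a fixed monomial, then in F against the fixed G. *)
Lemma cov_cylinder A B F G M M' D :
  (forall K L : seq V, {subset K <= A} -> {subset L <= B} ->
    `|cov (contains R K) (contains R L)| <= D) ->
  depends_on A F -> (forall mu, `|F mu| <= M) ->
  depends_on B G -> (forall mu, `|G mu| <= M') ->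
  `|cov F G| <= 3 ^+ (size A + size B) * (M * M') * D.
Proof.
move=> hD hF FM hG GM.
have dc K := @depends_on_contains V R K.
have H K : {subset K <= A} -> `|cov (contains R K) G| <= 3 ^+ size B * M' * D.
  move=> sK; apply: (cylinder_linear_bound (L := cov (contains R K)) (A := B))
    => //.
  - move=> C F1 F2 h1 h2; rewrite ![cov (contains R K) _]covC.
    exact: (covDl h1 h2 (dc K)).
  - move=> C F1 c h1; rewrite ![cov (contains R K) _]covC.
    exact: (covZl c h1 (dc K)).
  - by move=> L sL; apply: hD.
have := cylinder_linear_bound (L := cov^~ G)
  (fun C F1 F2 h1 h2 => covDl h1 h2 hG) (fun C F1 c h1 =>
    covZl c h1 hG) H hF FM.
by rewrite exprD; move/le_trans; apply; rewrite le_eqVlt; apply/orP; left;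
  apply/eqP; ring.
Qed.

End covariance.

Lemma translateE (V : groupType) (x : V) mu y :
  translate x^-1%g mu y <-> mu (x * y)%g.
Proof.
split=> [[v mv <-]|m]; first by rewrite mulVKg.
by exists (x * y)%g => //; rewrite mulKg.
Qed.

(** * Clustering of the spin model as a covariance bound for monomials *)

Section model.
Variables (R : realType) (V : groupType) (S : set V) (d : measure_display)
  (Omega : measurableType d) (Pr : probability Omega R)
  (X : {RV Pr >-> spins V}).

Lemma measurable_site x : measurable [set w | (X w : set V) x].
Proof.
have mX : measurable_fun setT X by [].
rewrite -[X in measurable X]setTI; apply: (mX measurableT [set mu : set V | mu
  x]).
by apply: sub_sigma_algebra; exists x.
Qed.

Lemma mean_contains K :
  (mean Pr (fun w => contains R K (X w)))%:E = prob_contains X [set` K].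
Proof.
have mE : measurable [set w | forall x, x \in K -> (X w : set V) x].
  elim: K => [|a K IH].
    by rewrite (_ : [set _ | _] = setT) //; apply/seteqP; split.
  rewrite (_ : [set _ | _] = [set w | (X w : set V) a] `&`
     [set w | forall x, x \in K -> (X w : set V) x]).
    by apply: measurableI => //; apply: measurable_site.
  apply/seteqP; split=> w /=.
    by move=> h; split=> [|x xK]; apply: h; rewrite inE ?eqxx ?xK ?orbT.
  by case=> ha hK x; rewrite inE => /orP[/eqP->//|/hK].
have E : (fun w => contains R K (X w)) =
    \1_[set w | forall x, x \in K -> (X w : set V) x].
  apply/funext => w; rewrite indicE /contains.
  by [].
rewrite /mean E /Rintegral integral_indic// setIT fineK;
  last exact: fin_num_measure.
by [].
Qed.

(** The monomials met here may repeat sites or be empty, while clustering speaks of nonempty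
    families of distinct points. Duplicates are removed, an empty monomial is the constant 1 and has
    covariance 0, and monotonicity of [C], [c] and [phi] passes from the actual number of sites and
    distance to N and r. *)
Lemma cov_contains (C c : nat -> R) phi K L N r :
  fast_decreasing phi -> clustering_with S X C c phi ->
  (0 < r)%N -> (size (undup K) + size (undup L) <= N)%N ->
  (forall x y, x \in K -> y \in L -> (r <= dist S x y)%N) ->
  `|cov Pr X (contains R K) (contains R L)| <= C N * phi (c N * r%:R).
Proof.
move=> [phi01 phimono _] [C0 Cmono c0 cmono hcl] r0 KLN hKL.
have D0 : 0 <= C N * phi (c N * r%:R).
  have cr : 0 <= c N * r%:R by rewrite mulr_ge0// ltW.
  by rewrite mulr_ge0 //; [rewrite ltW|case/andP: (phi01 _ cr)].
have cov1 F : cov Pr X (contains R [::]) F = 0.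
  rewrite /cov (_ : contains R [::] = (fun=> 1)); last first.
    by apply/funext => mu; rewrite contains_nil.
  rewrite mean_cst mul1r (_ : (fun w => 1 * _) = (fun w => F (X w))) ?subrr//.
  by apply/funext => w; rewrite mul1r.
have undupE (K' : seq V) : contains R (undup K') = contains R K'.
  apply/funext => mu; congr (_%:R); congr nat_of_bool; apply: asbool_equiv_eq.
  by split=> h x xK; apply: h; move: xK; rewrite mem_undup.
rewrite -(undupE K) -(undupE L).
have [->|K0] := eqVneq (undup K) [::]; first by rewrite cov1 normr0.
have [->|L0] := eqVneq (undup L) [::]; first by rewrite covC cov1 normr0.
set K' := undup K in K0 *; set L' := undup L in L0 *.
pose p := size K'; pose q := size L'.
pose x (i : 'I_(p + q)) := nth 1%g (K' ++ L') i.
have p0 : (1 <= p)%N by rewrite lt0n size_eq0.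
have q0 : (1 <= q)%N by rewrite lt0n size_eq0.
(* A common site would be at distance 0 from itself, contradicting r > 0. *)
have uKL : uniq (K' ++ L').
  rewrite cat_uniq !undup_uniq andbT /=; apply/hasPn => y.
  rewrite /L' mem_undup => yL; apply/negP; rewrite /K' /= mem_undup => yK.
  have := hKL _ _ yK yL; rewrite leqNgt => /negP; apply.
  by apply: leq_ltn_trans r0; apply: (@dist_le_size _ _ y [::]).
have xinj : injective x.
  move=> i j /eqP; rewrite nth_uniq ?size_cat// => /eqP e; exact: val_inj.
have rA : range (x \o lshift q) = [set` K'].
  apply/seteqP; split=> y /=.
    by case=> i _ <-; rewrite /x /= nth_cat (ltn_ord i) mem_nth.
  move=> yK; have iy : (index y K' < p)%N by rewrite index_mem.
  by exists (Ordinal iy) => //; rewrite /x /= nth_cat index_mem yK nth_index.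
have rB : range (x \o @rshift p q) = [set` L'].
  apply/seteqP; split=> y /=.
    by case=> i _ <-; rewrite /x /= nth_cat ltnNge leq_addr addKn mem_nth.
  move=> yK; have iy : (index y L' < q)%N by rewrite index_mem.
  exists (Ordinal iy) => //.
  by rewrite /x /= nth_cat ltnNge leq_addr addKn nth_index.
have rAB : range x = [set` K' ++ L'].
  apply/seteqP; split=> y /=.
    by case=> i _ <-; rewrite /x mem_nth// size_cat.
  move=> yK; have iy : (index y (K' ++ L') < p + q)%N by rewrite -size_cat
    index_mem.
  by exists (Ordinal iy) => //; rewrite /x /= nth_index.
have := hcl p q x p0 q0 xinj; rewrite /= rA rB rAB -!mean_contains.
rewrite -EFinM -EFinB abse_EFin lee_fin => H.
have -> : cov Pr X (contains R K') (contains R L') =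
    mean Pr (fun w => contains R (K' ++ L') (X w)) -
    mean Pr (fun w => contains R K' (X w)) * mean Pr (fun w =>
      contains R L' (X w)).
  rewrite /cov; congr (mean _ _ - _); apply/funext => w.
  elim: (K') => [|a K'' IH]; first by rewrite contains_nil mul1r.
  by rewrite cat_cons !contains_cons -IH mulrA.
have [a [b [aK bL dab]]] : exists a b, [/\ a \in K, b \in L &
    setdist S [set` K'] [set` L'] = dist S a b].
  have [||a [b [aK bL E]]] := @setdist_attained _ S [set` K'] [set` L'].
  - by case: (K') K0 => // a ? _; exists a; rewrite /= inE eqxx.
  - by case: (L') L0 => // a ? _; exists a; rewrite /= inE eqxx.
  by exists a, b; split => //; [move: aK|move: bL];
    rewrite /= /K' /L' mem_undup.
apply: le_trans H _; rewrite dab.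
have cd : 0 <= c (p + q)%N * (dist S a b)%:R by rewrite mulr_ge0// ltW.
apply: ler_pM.
- exact: ltW.
- by case/andP: (phi01 _ cd).
- exact: Cmono KLN.
apply: phimono; first by rewrite mulr_ge0// ltW.
apply: ler_pM => //; [exact: ltW|exact: cmono KLN|].
by rewrite ler_nat hKL.
Qed.

End model.

Lemma norm_prodX_le (R : realType) m (a : 'I_m -> R) (k : 'I_m -> nat) M :
  (forall i, `|a i| <= M) -> `|\prod_(i < m) a i ^+ k i| <= M ^+ (\sum_(i < m)
    k i)%N.
Proof.
move=> aM; rewrite normr_prod -prodrXr; apply: ler_prod => i _.
rewrite normr_ge0 /= normrX; have := aM i; case: (k i) => // j h.
by rewrite lerXn2r// nnegrE// (le_trans _ h).
Qed.

(** * Truncation of a score at a stabilisation radius *)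

Section truncation.
Variables (R : realType) (V : groupType) (S : set V) (xi : V -> set V -> R).
Hypotheses (hS : cayley_data S) (hxi : score_function xi).

(* For [t >= 1] this says that R(x, mu) <= t. *)
Definition stable (t : nat) (x : V) (mu : set V) : Prop :=
  determined_in S xi t%:R (translate x^-1%g mu).

(** With the default value 0, a product of positive powers of truncated scores is either the
    original product or 0, so its moments are controlled by those of the original. *)
Definition trunc_score (t : nat) (x : V) (mu : set V) : R :=
  if `[< stable t x mu >] then xi x mu else 0.

Lemma score_translate x mu : xi x mu = xi 1%g (translate x^-1%g mu).
Proof.
have [_ inv _] := hxi; rewrite -[RHS](inv x) mulg1; congr xi.
apply/seteqP; split=> y.
  by move=> my; exists (x^-1 * y)%g; [apply/translateE;
    rewrite mulVKg|rewrite mulVKg].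
by case=> u /translateE mu' <-.
Qed.

Lemma determined_mono (r r' : R) mu : r <= r' ->
  determined_in S xi r mu -> determined_in S xi r' mu.
Proof.
move=> rr' h nu e; apply: h.
have WE : window S r%:E 1%g = window S r'%:E 1%g `&` window S r%:E 1%g.
  apply/seteqP; split=> y; rewrite /window /=; last by case.
  by rewrite !lee_fin => yr; split=> //; apply: le_trans yr rr'.
by rewrite WE !setIA e.
Qed.

Lemma translate_window t x mu nu :
  (forall y, y \in ball_seq S t x -> mu y <-> nu y) ->
  translate x^-1%g mu `&` window S (t%:R%:E : \bar R) 1%g =
  translate x^-1%g nu `&` window S (t%:R%:E : \bar R) 1%g.
Proof.
move=> h; rewrite window_natE.
by apply/seteqP; split=> y [/translateE my] /= dy; split=> //; apply/translateE;
  apply/h => //; rewrite mem_ball_seq// -{1}(mulg1 x) dist_mull.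
Qed.

(** Configurations that agree on the ball have the same competitors in [determined_in], and each is
    a competitor of the other. *)
Lemma stable_ball t x mu nu :
  (forall y, y \in ball_seq S t x -> mu y <-> nu y) ->
  stable t x mu -> stable t x nu /\ xi x mu = xi x nu.
Proof.
move=> /translate_window e h.
have E := h _ (esym e).
split; last by rewrite (score_translate x mu) (score_translate x nu).
by move=> rho er; rewrite -E; apply: h; rewrite er.
Qed.

Lemma depends_on_stable t x : depends_on (ball_seq S t x) (stable t x).
Proof.
move=> mu nu h; apply/propext; split; first by case/(stable_ball h).
by case/(stable_ball (fun y yx => iff_sym (h y yx))).
Qed.

Lemma depends_on_trunc t x : depends_on (ball_seq S t x) (trunc_score t x).
Proof.
move=> mu nu h; rewrite /trunc_score -(depends_on_stable h).
by case: asboolP => // /(stable_ball h)[].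
Qed.

Lemma trunc_score_stable t x mu : stable t x mu -> trunc_score t x mu = xi x mu.
Proof. by move=> h; rewrite /trunc_score asboolT. Qed.

(** Where the score is stable, it equals the score at the identity of the translated configuration
    cut down to the window of radius t, which is the kind of value that the growth condition
    bounds. *)
Lemma trunc_score_le t (M : R) :
  (forall mu, `|xi 1%g (mu `&` window S (t%:R%:E : \bar R) 1%g)| <= M) ->
  forall x mu, `|trunc_score t x mu| <= M.
Proof.
move=> hM x mu; have M0 : 0 <= M by apply: le_trans (hM set0).
rewrite /trunc_score; case: asboolP => [h|_]; last by rewrite normr0.
rewrite score_translate (h (translate x^-1%g mu `&` window S (t%:R%:E : \bar R)
  1%g)) //.
by rewrite -setIA setIid.
Qed.

End truncation.

Lemma depends_on_setI (V : groupType) (U : Type) A (F : set V -> U) (W : set V)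
  :
  depends_on A F -> depends_on A (fun mu => F (mu `&` W)).
Proof.
by move=> h mu nu e; apply: h => x /e [h1 h2]; split=> -[m w]; split; auto.
Qed.

Lemma depends_on_prod (R : realType) (V : groupType) m A (F : 'I_m -> set V ->
  R)
    (k : 'I_m -> nat) : (forall i, depends_on A (F i)) ->
  depends_on A (fun mu => \prod_(i < m) F i mu ^+ k i).
Proof. by move=> h mu nu e; apply: eq_bigr => i _; rewrite (h i mu nu e). Qed.

(** * Covariance bound for products of truncated scores *)

Section truncated_moments.
Variables (R : realType) (V : groupType) (S : set V) (d : measure_display)
  (Omega : measurableType d) (Pr : probability Omega R)
  (X : {RV Pr >-> spins V}) (xi : V -> set V -> R).
Hypotheses (hS : cayley_data S) (hxi : score_function xi).

(** The window is cut inside a function of the full configuration, so the sites it depends on can be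
    chosen independently of n. *)
Definition tprod t (n : \bar R) m (z : 'I_m -> V) (k : 'I_m -> nat) (mu : set
  V) : R :=
  \prod_(i < m) trunc_score S xi t (z i) (mu `&` window S n 1%g) ^+ k i.

Definition balls t m (z : 'I_m -> V) : seq V :=
  flatten [seq ball_seq S t (z i) | i <- enum 'I_m].

Lemma mem_balls t m (z : 'I_m -> V) x : x \in balls t z ->
  exists i, (dist S (z i) x <= t)%N.
Proof.
by case/flattenP => _ /mapP[i _ ->]; rewrite mem_ball_seq// => h; exists i.
Qed.

Lemma size_balls t m (z : 'I_m -> V) :
  size (balls t z) = (m * size (ball_seq S t 1%g))%N.
Proof.
rewrite size_flatten /shape -map_comp sumnE big_map.
rewrite (eq_bigr (fun=> size (ball_seq S t 1%g))); last first.
  by move=> i _ /=; rewrite size_ball_seq.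
by rewrite big_enum /= sum_nat_const card_ord.
Qed.

Lemma depends_on_tprod t (n : \bar R) m (z : 'I_m -> V) k : depends_on (balls t
  z) (tprod t n z k).
Proof.
apply: depends_on_prod => i; apply: depends_on_setI.
apply: depends_on_sub (depends_on_trunc hS hxi (x := z i)) => x xi'.
by apply/flattenP; exists (ball_seq S t (z i)) => //; apply: map_f;
  rewrite mem_enum.
Qed.

Lemma tprod_cov (C c : nat -> R) phi t (M : R) (n : \bar R) p q (z : 'I_(p + q)
  -> V) k :
  fast_decreasing phi -> clustering_with S X C c phi ->
  (forall x mu, `|trunc_score S xi t x mu| <= M) ->
  (forall i, (1 <= k i)%N) ->
  let K := (\sum_(i < p + q) k i)%N in
  let N := (K * size (ball_seq S t 1%g))%N in
  let s := setdist S (range (z \o lshift q)) (range (z \o @rshift p q)) in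
  (t.*2 < s)%N ->
  `|cov Pr X (tprod t n (z \o lshift q) (k \o lshift q))
      (tprod t n (z \o @rshift p q) (k \o @rshift p q))|
   <= 3 ^+ N * M ^+ K * (C N * phi (c N * (s - t.*2)%:R)).
Proof.
move=> hphi hcl hM k1 K N s ts.
have hM0 : 0 <= M by apply: le_trans (hM 1%g set0).
(* Each exponent is at least 1; this trades the number of points for K in all constants. *)
have pqK : (p + q <= K)%N.
  by rewrite -[X in (X <= _)%N](card_ord (p + q)) -sum1_card leq_sum.
have sizeAB : (size (balls t (z \o lshift q)) +
    size (balls t (z \o @rshift p q)) <= N)%N.
  by rewrite !size_balls -mulnDl leq_mul.
have KE : K = (\sum_(i < p) (k \o lshift q) i + \sum_(i < q) (k \o @rshift p q)
  i)%N.
  by rewrite /K big_split_ord.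
pose e1 := (\sum_(i < p) (k \o lshift q) i)%N.
pose e2 := (\sum_(i < q) (k \o @rshift p q) i)%N.
apply: (@le_trans _ _ (3 ^+ (size (balls t (z \o lshift q)) +
    size (balls t (z \o @rshift p q))) * (M ^+ e1 * M ^+ e2) *
    (C N * phi (c N * (s - t.*2)%:R)))).
  apply: cov_cylinder; first exact: measurable_site.
  2,4: exact: depends_on_tprod.
  - move=> K1 K2 s1 s2.
  apply: (cov_contains hphi hcl (r := (s - t.*2)%N) (N := N)).
  + by rewrite subn_gt0.
  + apply: leq_trans sizeAB; apply: leq_add; apply: uniq_leq_size;
      rewrite ?undup_uniq// => x; rewrite mem_undup; [exact: s1|exact: s2].
  + move=> x y /s1/mem_balls[i di] /s2/mem_balls[j dj].
    (* Two triangle inequalities: each site is within t of its centre, and centres of different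
       groups are at least s apart. *)
    rewrite leq_subLR; apply: (@leq_trans (dist S (z (lshift q i)) (z (rshift p
      j)))).
      by apply: setdist_le; [exists i|exists j].
    apply: leq_trans (dist_triangle hS _ x _) _.
    rewrite -addnn -addnA leq_add//.
    apply: leq_trans (dist_triangle hS _ y _) _.
    by rewrite addnC leq_add// dist_sym.
  - by move=> mu; apply: norm_prodX_le => i; apply: hM.
  - by move=> mu; apply: norm_prodX_le => i; apply: hM.
rewrite -exprD -KE ler_wpM2r//.
  have [phi01 _ _] := hphi; have [C0 _ c0 _ _] := hcl.
  rewrite mulr_ge0 ?(ltW (C0 _))//.
  have /phi01/andP[//] : 0 <= c N * (s - t.*2)%:R.
  by rewrite mulr_ge0// ltW.
rewrite ler_wpM2r ?exprn_ge0//.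
by apply: ler_weXn2l => //; rewrite ler1n.
Qed.

End truncated_moments.

(** * Elementary bounds on means and covariances *)

Section mean_bound.
Variables (R : realType) (d : measure_display) (T : measurableType d)
  (Pr : probability T R).

Lemma integ_cst c : integ Pr (fun=> c).
Proof.
by apply: (@integ_bounded _ _ _ _ _ `|c|); [exact: measurable_cst|move=> _;
  exact: lexx].
Qed.

Lemma integD (f g : T -> R) : integ Pr f -> integ Pr g -> integ Pr (fun w =>
  f w + g w).
Proof. by move=> hf hg; exact: (integrableD measurableT hf hg). Qed.

Lemma integB (f g : T -> R) : integ Pr f -> integ Pr g -> integ Pr (fun w =>
  f w - g w).
Proof. by move=> hf hg; exact: (integrableB measurableT hf hg). Qed.

Lemma integZ (f : T -> R) c : integ Pr f -> integ Pr (fun w => c * f w).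
Proof. by move=> hf; exact: (integrableZl measurableT c hf). Qed.

Lemma mean_norm_bound f M : integ Pr f -> (forall w, `|f w| <= M) -> `|mean Pr
  f| <= M.
Proof.
by move=> hf fM; rewrite -[M](mean_cst Pr); apply: mean_norm_le => //;
  exact: integ_cst.
Qed.

Lemma expectation_mean f : integ Pr f -> ('E_Pr[f])%E = (mean Pr f)%:E.
Proof.
by move=> hf; rewrite unlock /mean /Rintegral fineK//;
  apply: integrable_fin_num.
Qed.

Lemma cov_norm_le (V : groupType) (X : T -> set V) A B (F G : set V -> R) M M' :
  (forall x, measurable [set w | X w x]) ->
  depends_on A F -> depends_on B G ->
  (forall mu, `|F mu| <= M) -> (forall mu, `|G mu| <= M') ->
  `|cov Pr X F G| <= 2 * (M * M').
Proof.
move=> mX hF hG FM GM.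
have sA : {subset A <= A ++ B} by move=> x; rewrite mem_cat => ->.
have sB : {subset B <= A ++ B} by move=> x; rewrite mem_cat orbC => ->.
rewrite /cov mulr2n mulrDl mul1r; apply: le_trans (ler_normB _ _) _;
  apply: lerD.
  apply: mean_norm_bound => [|w]; last by rewrite normrM ler_pM.
  apply: (integ_cylinder Pr mX (A := A ++ B) (F := fun mu => F mu * G mu)).
  exact: depends_on_op2 (depends_on_sub sA hF) (depends_on_sub sB hG).
rewrite normrM ler_pM//; apply: mean_norm_bound => //.
  exact: (integ_cylinder Pr mX hF).
exact: (integ_cylinder Pr mX hG).
Qed.

End mean_bound.

(** * Clustering for local scores *)

Section local_score.
Variables (R : realType) (V : groupType) (S : set V) (d : measure_display)
  (Omega : measurableType d) (Pr : probability Omega R)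
  (X : {RV Pr >-> spins V}) (xi : V -> set V -> R).
Hypotheses (hS : cayley_data S) (hxi : score_function xi).

Lemma tprod_split t n p q (z : 'I_(p + q) -> V) k mu :
  tprod S xi t n z k mu = tprod S xi t n (z \o lshift q) (k \o lshift q) mu *
    tprod S xi t n (z \o @rshift p q) (k \o @rshift p q) mu.
Proof. by rewrite /tprod big_split_ord. Qed.

Lemma local_stable : local S xi ->
  exists2 t : nat, (0 < t)%N & forall x mu, stable S xi t x mu.
Proof.
case=> r r0 h; exists (Num.trunc r).+1 => // x mu.
by apply: determined_mono (h _); apply/ltW/truncnS_gt.
Qed.

Lemma mixed_moment_stable t n m (z : 'I_m -> V) k :
  (forall x mu, stable S xi t x mu) ->
  mixed_moment S X xi n z k = (mean Pr (fun w => tprod S xi t n z k (X w)))%:E.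
Proof.
move=> st; rewrite -expectation_mean; last first.
    exact: (integ_cylinder Pr (measurable_site X) (depends_on_tprod hS hxi _
      _)).
rewrite /mixed_moment; congr ('E_Pr[_])%E; apply/funext => w.
by apply: eq_bigr => i _; rewrite trunc_score_stable.
Qed.

(** For s <= 4t the two groups of balls may meet and only the trivial bound is available, while
    [phi] might already vanish there. Raising it to 1 on [0, 1] and rescaling s absorbs this
    range. *)
Definition truncated_at_one (phi : R -> R) (u : R) : R := if u <= 1 then 1 else
  phi u.

Lemma fast_decreasing_truncated phi :
  fast_decreasing phi -> fast_decreasing (truncated_at_one phi).
Proof.
move=> [phi01 phimono phi0]; rewrite /truncated_at_one; split.
- by move=> s s0; case: ifP => _; [rewrite ler01 lexx|exact: phi01].
- move=> s t s0 st; case: ifP => t1; first by rewrite (le_trans st t1).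
  case: ifP => _; last exact: phimono.
  by have /andP[] := phi01 t (le_trans s0 st).
- move=> m m1; apply: cvg_trans (phi0 m m1); apply: near_eq_cvg.
  near=> s; rewrite leNgt ifF//; apply/negbTE; rewrite negbK.
  by near: s; apply: nbhs_pinfty_gt; exact: num_real.
Unshelve. all: by end_near. Qed.

(** The functions differ only where c|x| <= 1, a finite ball, and each of its points adds at most 1
    to the sum. *)
Lemma summable_truncated phi : fast_decreasing phi ->
  summable_in S phi -> summable_in S (truncated_at_one phi).
Proof.
move=> [phi01 _ _] hs c p c0 p1.
pose B := [set x | c * (norm S x)%:R <= 1].
have finB : finite_set B.
  apply: sub_finite_set (finite_ball hS (Num.trunc c^-1)) => x /=.
  rewrite /B /= mulrC -ler_pdivlMr// div1r => h.
  by rewrite truncn_ge_nat// invr_ge0 ltW.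
pose a (x : V) : \bar R := (phi (c * (norm S x)%:R) `^ p^-1)%:E.
pose b (x : V) : \bar R := if x \in B then 1%E else 0%E.
have a0 x : (0 <= a x)%E by rewrite lee_fin powR_ge0.
have b0 x : (0 <= b x)%E by rewrite /b; case: ifP.
apply: (@le_lt_trans _ _ (\esum_(x in [set: V]) (a x + b x)%E)).
  apply: le_esum => x _; rewrite /truncated_at_one; case: ifPn => h.
    by rewrite powR1 /b ifT ?inE// -{1}(add0e 1%E) leeD2r.
  by rewrite -{1}(adde0 (_ `^ _)%:E) leeD2l.
rewrite esumD => [|x _|x _] //; apply: lte_add_pinfty; first exact: hs.
rewrite -esum_mkcond esum_fset// fsbig_finite//=.
by rewrite sumEFin ltry.
Qed.

(** The rate is a minimum of two: (4t)^-1 sends s <= 4t into [0, 1], where the trivial bound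
    suffices, and c_N / 2 comes from s - 2t >= s / 2 when s > 4t. *)
Lemma local_clustering (C c : nat -> R) phi t M n p q (z : 'I_(p + q) -> V) k :
  fast_decreasing phi -> clustering_with S X C c phi ->
  (0 < t)%N -> (forall x mu, stable S xi t x mu) ->
  (forall x mu, `|trunc_score S xi t x mu| <= M) ->
  (forall i, (1 <= k i)%N) ->
  let K := (\sum_(i < p + q) k i)%N in
  let N := (K * size (ball_seq S t 1%g))%N in
  let s := setdist S (range (z \o lshift q)) (range (z \o @rshift p q)) in
  is_true (`| mixed_moment S X xi n z k
      - mixed_moment S X xi n (z \o lshift q) (k \o lshift q)
        * mixed_moment S X xi n (z \o @rshift p q) (k \o @rshift p q) |
    <= ((2 * M ^+ K + 3 ^+ N * M ^+ K * C N) *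
        truncated_at_one phi (Num.min (4 * t%:R)^-1 (c N / 2) * s%:R))%:E)%E.
Proof.
move=> hphi hcl t0 st hM k1 K N s.
rewrite !(mixed_moment_stable _ _ _ st) -EFinM -EFinB abse_EFin lee_fin.
under [X in mean Pr X]eq_fun do rewrite tprod_split.
rewrite -/(cov Pr X (tprod S xi t n (z \o lshift q) (k \o lshift q))
  (tprod S xi t n (z \o @rshift p q) (k \o @rshift p q))).
set F := tprod _ _ _ _ _ _; set G := tprod _ _ _ _ _ _.
have hM0 : 0 <= M by apply: le_trans (hM 1%g set0).
have KE : K = (\sum_(i < p) (k \o lshift q) i + \sum_(i < q) (k \o @rshift p q)
  i)%N.
  by rewrite /K big_split_ord.
have [phi01 phimono _] := hphi; have [C0 _ c0 _ _] := hcl.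
have MK0 : 0 <= M ^+ K by rewrite exprn_ge0.
have N30 : 0 <= 3 ^+ N * M ^+ K * C N :> R.
  by rewrite !mulr_ge0// ?exprn_ge0// ltW.
have t4 : 0 < 4 * t%:R :> R by rewrite mulr_gt0// ltr0n.
have u0 : 0 <= Num.min (4 * t%:R)^-1 (c N / 2) * s%:R.
  by rewrite mulr_ge0// le_min invr_ge0 ltW//= divr_ge0// ltW.
set u := Num.min _ _ * _ in u0 *.
have [s4|s4] := leqP s (4 * t).
  rewrite /truncated_at_one ifT; last first.
    rewrite /u (@le_trans _ _ ((4 * t%:R)^-1 * s%:R))//.
      by rewrite ler_wpM2r// ge_min lexx.
    by rewrite mulrC ler_pdivrMr// mul1r -natrM ler_nat.
  rewrite mulr1 (@le_trans _ _ (2 * M ^+ K))//; last by rewrite lerDl.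
  rewrite KE exprD.
  apply: (cov_norm_le Pr (measurable_site X) (depends_on_tprod hS hxi _ _)
    (depends_on_tprod hS hxi _ _)) => mu; exact: norm_prodX_le.
apply: le_trans (tprod_cov hS hxi n hphi hcl hM k1 _) _.
  by rewrite -/s; lia.
rewrite -/K -/N -/s mulrA.
have -> : 3 ^+ N * M ^+ K * C N * phi (c N * (s - t.*2)%:R) =
  0 + 3 ^+ N * M ^+ K * C N * phi (c N * (s - t.*2)%:R) by rewrite add0r.
have phiu : phi (c N * (s - t.*2)%:R) <= truncated_at_one phi u.
  have h : u <= c N * (s - t.*2)%:R.
    rewrite /u (@le_trans _ _ (c N / 2 * s%:R))//.
      by rewrite ler_wpM2r// ge_min lexx orbT.
    rewrite -mulrA; apply: ler_wpM2l; first exact: ltW.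
    by rewrite mulrC ler_pdivrMr// -natrM ler_nat; lia.
  rewrite (le_trans (phimono _ _ u0 h))// /truncated_at_one; case: ifP => // _.
  by case/andP: (phi01 _ u0).
rewrite mulrDl lerD//; last by rewrite ler_wpM2l.
rewrite mulr_ge0// ?mulr_ge0//; apply: le_trans phiu.
by case/andP: (phi01 _ (mulr_ge0 (ltW (c0 N)) (ler0n R (s - t.*2)))).
Qed.

Lemma condition1_clusters phi : condition1 S X xi phi ->
  mixed_moments_cluster S X xi (truncated_at_one phi).
Proof.
move=> [_ [_ _ hphi [C [c hcl]]] /local_stable[t t0 st]].
split; first exact: fast_decreasing_truncated.
(* A local score is bounded: at the identity it is a function of finitely many spins, and
   translation carries the bound to every x. The maximum with 1 keeps the final constants
   positive. *)
have [M0 hM0] : exists M0, forall mu, `|trunc_score S xi t 1%g mu| <= M0.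
  exact: cylinder_bounded (depends_on_trunc hS hxi (x := 1%g)).
pose M := Num.max M0 1.
have hM x mu : `|trunc_score S xi t x mu| <= M.
  apply: trunc_score_le => // nu.
  by rewrite -(trunc_score_stable (st _ _)) (le_trans (hM0 _))// le_max lexx.
have M1 : 1 <= M by rewrite le_max lexx orbT.
have [C0 _ c0 _ _] := hcl.
pose N K := (K * size (ball_seq S t 1%g))%N.
exists (fun K => 2 * M ^+ K + 3 ^+ N K * M ^+ K * C (N K)).
exists (fun K => Num.min (4 * t%:R)^-1 (c (N K) / 2)); split.
  move=> K _; split.
    by rewrite addr_gt0// ?mulr_gt0// ?exprn_gt0// (lt_le_trans ltr01).
  by rewrite lt_min invr_gt0 mulr_gt0 ?ltr0n//= divr_gt0.
move=> n p q z k _ _ _ _ k1.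
exact: (local_clustering n z hphi hcl t0 st hM k1).
Qed.

End local_score.

(** * Error made by truncating a quasi-local score *)

Section stabilisation.
Variables (R : realType) (V : groupType) (S : set V) (d : measure_display)
  (Omega : measurableType d) (Pr : probability Omega R)
  (X : {RV Pr >-> spins V}) (xi : V -> set V -> R).
Hypotheses (hS : cayley_data S) (hxi : score_function xi).

Lemma measurable_score (n : \bar R) x :
  measurable_fun setT (fun w => xi x (in_window S X n w)).
Proof.
have [mxi _ _] := hxi.
pose g w : discrete V * spins V := (x, in_window S X n w).
have mw : measurable_fun setT (in_window S X n : Omega -> spins V).
  apply: (@measurability _ _ _ (spins V) setT _ (@site_events V)) => //.
  move=> A [B [y _ <-] <-].
  rewrite setTI; have [Wy|nWy] := pselect (window S n 1%g y).
    rewrite (_ : _ @^-1` _ = [set w | (X w : set V) y]);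
      first exact: measurable_site.
    by apply/seteqP; split=> w /= => [[]|].
  rewrite (_ : _ @^-1` _ = set0) //.
  by apply/seteqP; split=> w // [_ /nWy].
have mg : measurable_fun setT g.
  by apply: measurable_fun_pair => //; exact: measurable_cst.
exact: (measurableT_comp mxi mg).
Qed.

Definition unstable (t : nat) (n : \bar R) (x : V) (w : Omega) : R :=
  (~~ `[< stable S xi t x (in_window S X n w) >])%:R.

Lemma depends_on_unstable t (n : \bar R) x : depends_on (ball_seq S t x)
  (fun mu => (~~ `[< stable S xi t x (mu `&` window S n 1%g) >])%:R : R).
Proof.
move=> mu nu h; congr ((nat_of_bool (~~ `[< _ >]))%:R).
by apply: depends_on_setI h; exact: depends_on_stable.
Qed.

Lemma integ_unstable t n x : integ Pr (unstable t n x).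
Proof.
exact: (integ_cylinder Pr (measurable_site X) (@depends_on_unstable t n x)).
Qed.

(** The radius is an infimum over positive integers and stability is monotone in the radius, so for
    t > 0 instability at t is exactly the event that the radius is at least t + 1. *)
Lemma mean_unstable t n x (tau : R) : (0 < t)%N ->
  (Pr [set w | (t.+1%:R%:E <= stab_radius S xi x (in_window S X n w))%E] <=
    tau%:E)%E ->
  mean Pr (unstable t n x) <= tau.
Proof.
move=> t0; rewrite -lee_fin => H.
have mE : measurable [set w | ~ stable S xi t x (in_window S X n w)].
  have := cylinder_measurable (measurable_site X) (@depends_on_unstable t n x).
  move=> /(_ measurableT [set 1] (measurable_set1 _)).
  rewrite setTI; congr measurable; apply/seteqP; split=> w /=.
    by case: asboolP => //= _ /eqP; rewrite eq_sym oner_eq0.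
  by move=> h; rewrite asboolF.
have -> : unstable t n x = \1_[set w | ~ stable S xi t x (in_window S X n w)].
  apply/funext => w; rewrite indicE /unstable; congr (nat_of_bool _)%:R.
  by rewrite -asbool_neg.
rewrite /mean /Rintegral integral_indic// setIT fineK;
  last exact: fin_num_measure.
apply: le_trans H; rewrite le_eqVlt; apply/orP; left; apply/eqP; congr (Pr _).
apply/seteqP; split=> w /=.
  move=> h; apply: le_ereal_inf_tmp => _ [r [r0 hr] <-];
    rewrite lee_fin ler_nat ltnNge.
  by apply/negP => rt; apply: h; apply: determined_mono hr; rewrite ler_nat.
move=> h hst; have : (stab_radius S xi x (in_window S X n w) <= t%:R%:E)%E.
  by apply: ereal_inf_lbound; exists t.
by move/(le_trans h); rewrite lee_fin ler_nat ltnn.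
Qed.

Definition clipped n x w : R := Num.max `|xi x (in_window S X n w)| 1.

Lemma clipped_moment n x (e : nat) Mom :
  ('E_Pr[(fun w => Num.max `|xi x (in_window S X n w)| 1 `^ e%:R)%R] <=
    Mom%:E)%E ->
  integ Pr (fun w => clipped n x w ^+ e) /\
  mean Pr (fun w => clipped n x w ^+ e) <= Mom.
Proof.
rewrite (_ : (fun w => _) = (fun w => clipped n x w ^+ e)); last first.
  by apply/funext => w; rewrite powR_mulrn// le_max ler01 orbT.
move=> H.
have i : integ Pr (fun w => clipped n x w ^+ e).
  apply/integrableP; split.
    apply/measurable_EFinP; apply: measurable_funX.
    apply: measurable_maxr; last exact: measurable_cst.
    by apply: measurableT_comp (measurable_score n x).
  rewrite unlock in H; apply: le_lt_trans (ltry Mom); apply: le_trans H.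
  rewrite le_eqVlt; apply/orP; left; apply/eqP; apply: eq_integral => w _ /=.
  by rewrite ger0_norm// exprn_ge0// le_max ler01 orbT.
by split=> //; rewrite -lee_fin -expectation_mean.
Qed.

Definition sprod n m (z : 'I_m -> V) (k : 'I_m -> nat) w : R :=
  \prod_(i < m) xi (z i) (in_window S X n w) ^+ k i.

Lemma measurable_sprod n m (z : 'I_m -> V) k : measurable_fun setT (sprod n z
  k).
Proof.
rewrite /sprod; apply: measurable_prod => i _.
by apply: measurable_funX; exact: measurable_score.
Qed.

Lemma integ_sum m (f : 'I_m -> Omega -> R) : (forall i, integ Pr (f i)) ->
  integ Pr (fun w => \sum_(i < m) f i w) /\
  mean Pr (fun w => \sum_(i < m) f i w) = \sum_(i < m) mean Pr (f i).
Proof.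
elim: m f => [|m IH] f hf.
  under [X in integ _ X]eq_fun do rewrite big_ord0.
  under [X in mean _ X]eq_fun do rewrite big_ord0.
  by rewrite big_ord0 mean_cst; split=> //; exact: integ_cst.
under [X in integ _ X]eq_fun do rewrite big_ord_recr.
under [X in mean _ X]eq_fun do rewrite big_ord_recr.
have [i1 e1] := IH (fun i => f (widen_ord (leqnSn m) i)) (fun i => hf _).
rewrite meanD// big_ord_recr /= -e1; split=> //.
by apply: integD.
Qed.

Lemma sprod_outside n m (z : 'I_m -> V) k w i : (forall i, (1 <= k i)%N) ->
  ~ window S n 1%g (z i) -> sprod n z k w = 0.
Proof.
move=> k1 nz; have [_ _ xi0] := hxi.
by rewrite /sprod (bigD1 i)//= xi0 ?expr0n ?gtn_eqF ?mul0r// => -[].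
Qed.

Lemma tprod_outside t n m (z : 'I_m -> V) k mu i : (forall i, (1 <= k i)%N) ->
  ~ window S n 1%g (z i) -> tprod S xi t n z k mu = 0.
Proof.
move=> k1 nz; have [_ _ xi0] := hxi.
rewrite /tprod (bigD1 i)//= /trunc_score xi0; last by case.
by rewrite if_same expr0n gtn_eqF ?mul0r.
Qed.

Lemma tprod_unstable t n m (z : 'I_m -> V) k w : (forall i, (1 <= k i)%N) ->
  tprod S xi t n z k (X w) =
  if [forall i, `[< stable S xi t (z i) (in_window S X n w) >]]
  then sprod n z k w else 0.
Proof.
move=> k1; case: ifPn => [/forallP h|].
  by apply: eq_bigr => i _; rewrite trunc_score_stable//; apply/asboolP;
    exact: (h i).
rewrite negb_forall => /existsP[i hi].
by rewrite /tprod (bigD1 i)//= /trunc_score ifN// expr0n gtn_eqF ?mul0r.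
Qed.

(** On the unstable event |f| <= eps f^2 + eps^-1, and f^2 is dominated by the sum of the 2K-th
    powers of the clipped scores; hence the moment of order 2K. The parameter eps is left free to
    balance the moment against the tail. *)
Lemma stable_approx n t m (z : 'I_m -> V) k (K : nat) (eps Mom tau : R) :
  (1 <= m)%N -> (forall i, (1 <= k i)%N) -> (\sum_(i < m) k i <= K)%N ->
  0 < eps -> 0 <= Mom -> 0 <= tau -> (0 < t)%N ->
  (forall x, window S n 1%g x ->
    'E_Pr[(fun w => Num.max `|xi x (in_window S X n w)| 1 `^ (K.*2)%:R)%R] <=
      Mom%:E)%E ->
  (forall x, window S n 1%g x ->
    Pr [set w | (t.+1%:R%:E <= stab_radius S xi x (in_window S X n w))%E] <=
      tau%:E)%E ->
  [/\ integ Pr (sprod n z k), `|mean Pr (sprod n z k)| <= K%:R * Mom,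
     `|mean Pr (fun w => tprod S xi t n z k (X w))| <= K%:R * Mom &
     `|mean Pr (sprod n z k) - mean Pr (fun w => tprod S xi t n z k (X w))|
       <= K%:R * (eps * Mom + eps^-1 * tau)].
Proof.
move=> m1 k1 kK eps0 Mom0 tau0 t0 hMom htau.
have mK : (m <= K)%N.
  by apply: leq_trans kK; rewrite -[X in (X <= _)%N](card_ord m) -sum1_card
    leq_sum.
have KM0 : 0 <= K%:R * Mom by rewrite mulr_ge0.
have KE0 : 0 <= K%:R * (eps * Mom + eps^-1 * tau).
  by rewrite mulr_ge0// addr_ge0// mulr_ge0// ?invr_ge0 ltW.
(* Moments and tails are controlled in W_n only; a point outside it has score 0 and annihilates both
   products. *)
have [hz|] := pselect (forall i, window S n 1%g (z i)); last first.
  move=> /existsNP[i nz].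
  rewrite (_ : sprod n z k = fun=> 0); last first.
    by apply/funext => w; exact: sprod_outside nz.
  rewrite (_ : (fun w => tprod _ _ _ _ _ _ _) = fun=> 0); last first.
    by apply/funext => w; exact: tprod_outside nz.
  by rewrite mean_cst subrr normr0; split=> //; exact: integ_cst.
have hc i := clipped_moment (hMom _ (hz i)).
pose Y w := \sum_(i < m) clipped n (z i) w ^+ K.*2.
have [iY mY] := integ_sum (fun i => (hc i).1).
have mYle : mean Pr Y <= K%:R * Mom.
  rewrite mY (@le_trans _ _ (\sum_(i < m) Mom))//.
    by apply: ler_sum => i _; exact: (hc i).2.
  by rewrite sumr_const card_ord -[Mom *+ m]mulr_natl ler_wpM2r// ler_nat.
pose Z w := \sum_(i < m) unstable t n (z i) w.
have [iZ mZ] := integ_sum (fun i => integ_unstable t n (z i)).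
have mZle : mean Pr Z <= K%:R * tau.
  rewrite mZ (@le_trans _ _ (\sum_(i < m) tau))//.
    by apply: ler_sum => i _; exact: mean_unstable t0 (htau _ (hz i)).
  by rewrite sumr_const card_ord -[tau *+ m]mulr_natl ler_wpM2r// ler_nat.
(* B is the K-th power of the largest clipped score. Clipping at 1 allows total exponents below K,
   and B^2 is one of the summands of [Y]. *)
have fB w : exists B : R, [/\ 1 <= B, `|sprod n z k w| <= B & B ^+ 2 <= Y w].
  pose i0 : 'I_m := Ordinal m1.
  have [j hj] : exists j, forall i, clipped n (z i) w <= clipped n (z j) w.
    have [j _ hj] := @Order.TotalTheory.arg_maxP _ _ _ i0 xpredT (fun i =>
      clipped n (z i) w) isT.
    by exists j => i; exact: hj.
  have c1 i : 1 <= clipped n (z i) w by rewrite le_max lexx orbT.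
  exists (clipped n (z j) w ^+ K); split.
  - exact: exprn_ege1.
  - apply: le_trans (norm_prodX_le (M := clipped n (z j) w) _ _) _.
      by move=> i; apply: le_trans (hj i); rewrite le_max lexx.
    exact: ler_weXn2l.
  rewrite -exprM muln2 /Y (bigD1 j)//= lerDl sumr_ge0// => i _.
  by rewrite exprn_ge0// (le_trans ler01).
have fY w : `|sprod n z k w| <= Y w.
  have [B [B1 fB' BY]] := fB w; apply: le_trans fB' _; apply: le_trans BY.
  by rewrite expr2 ler_peMr// (le_trans ler01).
have iS : integ Pr (sprod n z k).
  apply: (le_integrable _ _ _ iY) => //.
    by apply/measurable_EFinP; exact: measurable_sprod.
  move=> w _ /=; rewrite lee_fin (le_trans (fY w))//; exact: ler_norm.
have iT : integ Pr (fun w => tprod S xi t n z k (X w)).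
  exact: (integ_cylinder Pr (measurable_site X) (depends_on_tprod hS hxi n k)).
have iQ : integ Pr (fun w => eps * Y w + eps^-1 * Z w).
  by apply: integD; exact: integZ.
split=> //.
- by apply: le_trans mYle; exact: mean_norm_le.
- apply: le_trans mYle; apply: mean_norm_le => // w.
  rewrite tprod_unstable//; case: ifP => // _; rewrite normr0.
  by apply: le_trans (fY w); exact: normr_ge0.
rewrite -meanB//; apply: (@le_trans _ _ (mean Pr (fun w =>
  eps * Y w + eps^-1 * Z w))).
  apply: mean_norm_le => //; first exact: integB.
  move=> w; rewrite tprod_unstable//; case: ifPn => [_|].
    rewrite subrr normr0 addr_ge0// mulr_ge0// ?invr_ge0 ?(ltW eps0)//.
      by apply: le_trans (fY w); exact: normr_ge0.
    by apply: sumr_ge0 => i _; exact: ler0n.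
  rewrite negb_forall => /existsP[i hi]; rewrite subr0.
  have Z1 : 1 <= Z w.
    rewrite /Z (bigD1 i)//= {1}/unstable hi lerDl sumr_ge0// => j _;
      exact: ler0n.
  have [B [B1 fB' BY]] := fB w; apply: le_trans fB' _.
  apply: (@le_trans _ _ (eps * B ^+ 2 + eps^-1)); last first.
    rewrite lerD//; first by rewrite ler_wpM2l// ltW.
    by rewrite ler_peMr// invr_ge0 ltW.
  (* Either B <= eps^-1, or eps B > 1 and then B <= eps B^2. *)
  have [h|h] := leP B eps^-1.
    by rewrite ler_wpDl// mulr_ge0 ?sqr_ge0// ltW.
  rewrite ler_wpDr// ?invr_ge0 ?(ltW eps0)// expr2 mulrA ler_peMl ?(le_trans
    ler01)//.
  by rewrite mulrC -ler_pdivrMr// div1r ltW.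
rewrite meanD//; last 2 first.
- exact: integZ.
- exact: integZ.
rewrite !meanZ// mulrDr lerD// mulrCA ler_wpM2l// ?invr_ge0 ltW//.
Qed.

End stabilisation.

(** * Calculus of stretched exponentials *)

Section stretched_exponential.
Variable R : realType.
Implicit Types (phi : R -> R).

Lemma powR_le_base (x y a : R) : 0 <= a -> 0 <= x -> x <= y -> x `^ a <= y `^ a.
Proof.
by move=> a0 x0 xy; apply: ge0_ler_powR => //; rewrite nnegrE// (le_trans x0).
Qed.

(** The negative limsup gives the bound beyond some T; on [0, T] monotonicity gives phi(u) <=
    |phi(0)|, and the factor exp(delta T^b) in D compensates the exponential. *)
Lemma stretched_expE phi (b : R) : 0 < b ->
  (forall s t, 0 <= s -> s <= t -> phi t <= phi s) -> stretched_exp_decay phi b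
    ->
  exists D delta, [/\ 0 < D, 0 < delta &
    forall u, 0 <= u -> phi u <= D * expR (- (delta * u `^ b))].
Proof.
move=> b0 mono /ereal_inf_lt[_ [A FA <-]] supA.
have [delta d0 hA] : exists2 delta : R, 0 < delta & forall t, A t ->
    (lne (phi t)%:E * ((t `^ b)^-1)%:E <= (- delta)%:E)%E.
  have ub t : A t -> (lne (phi t)%:E * ((t `^ b)^-1)%:E <=
      ereal_sup [set lne (phi t)%:E * ((t `^ b)^-1)%:E | t in A])%E.
    by move=> At; apply: ereal_sup_ubound; exists t.
  move: supA ub; case: ereal_sup => [r| |] // r0 ub.
    by exists (- r); rewrite ?opprK ?oppr_gt0.
  (* A supremum equal to -oo allows any rate. *)
  by exists 1 => // t /ub; rewrite leeNy_eq => /eqP ->; rewrite leNye.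
case: FA => M [_ MA]; pose T := Num.max M 1.
have T1 : 1 <= T by rewrite le_max lexx orbT.
exists (1 + `|phi 0| * expR (delta * T `^ b)), delta; split.
- by rewrite ltr_pwDl// mulr_ge0// expR_ge0.
- by [].
have E0 (x : R) : 0 <= expR x by exact: expR_ge0.
move=> u u0; rewrite mulrDl mul1r.
have [uT|Tu] := leP u T.
  rewrite ler_wpDl// -mulrA -expRD; apply: (@le_trans _ _ (`|phi 0| * 1)).
    by rewrite mulr1 (le_trans (mono 0 u _ _))// ler_norm.
  rewrite ler_wpM2l// -[X in X <= _]expR0 ler_expR subr_ge0 ler_wpM2l ?(ltW
    d0)//.
  by apply: powR_le_base => //; exact: ltW.
apply: ler_wpDr; first by rewrite !mulr_ge0.
have [phi0|phi0] := leP (phi u) 0; first exact: le_trans (E0 _).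
have Au : A u by apply: MA; rewrite (le_lt_trans _ Tu)// le_max lexx.
have u0' : 0 < u by apply: lt_trans Tu; apply: lt_le_trans T1.
have := hA u Au; rewrite lne_EFin// -EFinM lee_fin ler_pdivrMr ?powR_gt0//
  mulNr => h.
by rewrite -[phi u]lnK ?ler_expR.
Qed.

(** A single term of the exponential series, of degree n + 1 with beta (n + 1) >= m + 1, already
    outgrows s^m: the exponent m + 1 leaves a spare factor s, which eventually exceeds a / e. *)
Lemma fast_decreasing_stretched (eta beta : R) : 0 < eta -> 0 < beta ->
  fast_decreasing (fun s => expR (- (eta * s `^ beta))).
Proof.
move=> eta0 beta0; split.
- move=> s s0; rewrite expR_ge0 /= -[X in _ <= X]expR0 ler_expR oppr_le0.
  by rewrite mulr_ge0 ?powR_ge0// ltW.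
- move=> s t s0 st; rewrite ler_expR lerN2 ler_wpM2l ?(ltW eta0)//.
  by apply: powR_le_base => //; exact: ltW.
move=> m m1; pose n := Num.trunc (m.+1%:R / beta).
have nb : m.+1%:R <= beta * n.+1%:R.
  by rewrite mulrC -ler_pdivrMr//; apply/ltW/truncnS_gt.
pose a : R := (n.+1)`!%:R / eta ^+ n.+1.
have a0 : 0 < a by rewrite divr_gt0 ?exprn_gt0// ltr0n fact_gt0.
apply/cvgrPdist_lt => e e0; near=> s.
have s1 : 1 < s by near: s; apply: nbhs_pinfty_gt; exact: num_real.
have sa : a / e < s by near: s; apply: nbhs_pinfty_gt; exact: num_real.
have s0 : 0 < s by apply: lt_trans s1.
rewrite sub0r normrN ger0_norm; last by rewrite mulr_ge0 ?expR_ge0//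
  exprn_ge0// ltW.
pose u := eta * s `^ beta.
have u0 : 0 <= u by rewrite mulr_ge0 ?powR_ge0// ltW.
have hu : s ^+ m.+1 / a <= expR u.
  apply: le_trans (le_trans (ler_wpDl _ (lexx _)) (expR_ge1Dxn n u0)) => //.
  rewrite /a invf_div mulrA ler_wpM2r ?invr_ge0//.
  rewrite exprMn mulrC; apply: ler_wpM2l; first by rewrite exprn_ge0// ltW.
  rewrite -!powR_mulrn ?powR_ge0 ?(ltW s0)// -powRrM.
  by apply: ler_powR => //; exact: ltW.
rewrite expRN ltr_pdivrMr ?expR_gt0//.
apply: lt_le_trans (_ : e * (s ^+ m.+1 / a) <= _); last by rewrite ler_wpM2l//
  ltW.
have -> : e * (s ^+ m.+1 / a) = e * s / a * s ^+ m by rewrite exprS; ring.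
rewrite ltr_pMl ?exprn_gt0// ltr_pdivlMr// mul1r mulrC.
by rewrite -ltr_pdivrMr.
Unshelve. all: by end_near. Qed.

Lemma bigO_ge1 (f g : nat -> R) : f =O_\oo g -> (forall n, (1 <= n)%N -> 1 <= g
  n) ->
  exists2 D : R, 0 < D & forall n, (1 <= n)%N -> f n <= D * g n.
Proof.
move=> /eqO_exP[k k0 [N _ hN]] g1.
pose B := \sum_(i < N) `|f i|.
have B0 : 0 <= B by apply: sumr_ge0.
exists (k + B) => [|n n1]; first by rewrite ltr_pwDl.
have gn0 : 0 <= g n by rewrite (le_trans _ (g1 _ n1)).
rewrite mulrDl (le_trans (ler_norm _))//; have [Nn|nN] := leqP N n.
  apply: ler_wpDr; first by rewrite mulr_ge0.
    by rewrite -(ger0_norm gn0); exact: hN.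
rewrite ler_wpDl ?mulr_ge0 ?(ltW k0)// (@le_trans _ _ (B * 1))//.
  by rewrite mulr1 /B (bigD1 (Ordinal nN))//= lerDl sumr_ge0.
by rewrite ler_wpM2l// g1.
Qed.

(** Since gamma <= 1/2, t^2 <= s. If t >= 4 then 4t <= t^2 <= s; otherwise 4t < 16 <= s, which is
    where 16 comes from. *)
Lemma stretched_radius (s : nat) (gamma : R) : 0 < gamma -> gamma <= 1 / 2 ->
  (16 <= s)%N -> let t := Num.trunc (s%:R `^ gamma) in
  [/\ (0 < t)%N, (4 * t <= s)%N, t%:R <= s%:R `^ gamma & s%:R `^ gamma <=
    t.+1%:R].
Proof.
move=> g0 g2 s16 t.
have s1 : 1 <= s%:R :> R by rewrite ler1n; lia.
have ts : t%:R <= s%:R `^ gamma by rewrite -truncn_ge_nat ?powR_ge0.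
split=> //; last exact/ltW/truncnS_gt.
  rewrite truncn_ge_nat ?powR_ge0// -[X in X <= _](powRr0 s%:R).
  by apply: ler_powR => //; exact: ltW.
have : (t * t <= s)%N.
  rewrite -(ler_nat R) natrM (@le_trans _ _ (s%:R `^ gamma * s%:R `^ gamma))//.
    by rewrite ler_pM.
  rewrite -powRD; last by apply/implyP => _; rewrite gt_eqF// (lt_le_trans
    ltr01).
  by rewrite -[X in _ <= X](powRr1 (ler0n R s)); apply: ler_powR => //; lra.
nia.
Qed.

(* completing the square in [v] *)
Lemma expR_square (H delta v : R) : 0 < delta ->
  expR (H * v) * expR (- (delta * v ^+ 2)) <=
  expR (H ^+ 2 / (2 * delta)) * expR (- (delta / 2 * v ^+ 2)).
Proof.
move=> d0; rewrite -!expRD ler_expR -subr_ge0.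
have -> : H ^+ 2 / (2 * delta) + - (delta / 2 * v ^+ 2) -
    (H * v + - (delta * v ^+ 2)) = (delta * v - H) ^+ 2 / (2 * delta).
  by field; rewrite gt_eqF.
by rewrite divr_ge0 ?sqr_ge0// mulr_ge0// ltW.
Qed.

(** k^(ak) <= k^k <= (e^k)^k. The exponent k^2 is crude, but with k = N it remains a power of t. *)
Lemma powR_self_le_expR (a : R) (k : nat) : 0 <= a -> a < 1 -> (1 <= k)%N ->
  1 <= k%:R `^ (a * k%:R) :> R /\ k%:R `^ (a * k%:R) <= expR (k%:R ^+ 2) :> R.
Proof.
move=> a0 a1 k1.
have k1R : 1 <= k%:R :> R by rewrite ler1n.
split.
  by rewrite -[X in X <= _](powRr0 k%:R); apply: ler_powR => //;
    rewrite mulr_ge0.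
apply: (@le_trans _ _ (k%:R `^ k%:R)).
  by apply: ler_powR => //; rewrite ler_piMl// ltW.
rewrite powR_mulrn// expr2 expRM_natr; apply: lerXn2r;
  rewrite ?nnegrE ?expR_ge0//.
by rewrite (le_trans _ (expR_ge1Dx _))// lerDr.
Qed.

End stretched_exponential.

Lemma quarter_gap (s t : nat) : (16 <= s)%N -> (4 * t <= s)%N ->
  (t.*2 < s)%N /\ (s <= (s - t.*2) * 2)%N.
Proof. by move=> ? ?; split; lia. Qed.

Lemma exponent_sum (R : realType) (x y k w : R) :
  x <= y * w -> 2 * x + x + k * w <= (k + 3 * y) * w.
Proof.
move=> h; have -> : (k + 3 * y) * w = k * w + 3 * (y * w) by ring.
lra.
Qed.

Lemma error_sum (R : realType) (a1 a2 a3 a4 B T P Q v : R) :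
  a1 <= T * v -> a2 <= P * v -> a3 <= B * (T * v) -> a4 <= B * (T * v) ->
  0 <= Q * v -> a1 + a2 + (a3 + a4) <= (Q + ((1 + 2 * B) * T + P)) * v.
Proof.
move=> h1 h2 h3 h4 h5.
have -> : (Q + ((1 + 2 * B) * T + P)) * v =
    Q * v + T * v + P * v + (B * (T * v) + B * (T * v)) by ring.
lra.
Qed.

(** * Clustering for exponentially quasi-local scores *)

Section quasi_local_score.
Variables (R : realType) (V : groupType) (S : set V) (d : measure_display)
  (Omega : measurableType d) (Pr : probability Omega R)
  (X : {RV Pr >-> spins V}) (xi : V -> set V -> R).
Hypotheses (hS : cayley_data S) (hxi : score_function xi).

Lemma poly_growth_ball : polynomial_growth (R := R) S ->
  exists D a : R, [/\ 0 < D, 0 < a & forall t, (1 <= t)%N ->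
    (size (ball_seq S t 1%g))%:R <= D * t%:R `^ a].
Proof.
case=> a a0 hO; have [n n1|D D0 hD] := bigO_ge1 hO.
  by rewrite -[X in X <= _](powRr0 n%:R); apply: ler_powR; rewrite ?ler1n// ltW.
by exists D, a; split=> // t t1; rewrite -card_windowE; exact: hD.
Qed.

Lemma moment_bound : (forall p : R, 1 <= p -> moment_condition S X xi p) ->
  exists Mom : nat -> R, forall K, 0 <= Mom K /\
    ((1 <= K)%N -> forall n x, window_index n -> window S n 1%g x ->
    'E_Pr[(fun w => Num.max `|xi x (in_window S X n w)| 1 `^ (K.*2)%:R)%R]
      <= (Mom K)%:E)%E.
Proof.
move=> hm; suff bound K : exists M : R, 0 <= M /\
    ((1 <= K)%N -> forall n x, window_index n -> window S n 1%g x ->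
    'E_Pr[(fun w => Num.max `|xi x (in_window S X n w)| 1 `^ (K.*2)%:R)%R]
      <= M%:E)%E.
  by have [Mom hMom] := choice bound; exists Mom.
have [->|K0] := eqVneq K 0%N; first by exists 0; split.
have K1 : 1 <= (K.*2)%:R :> R by rewrite ler1n; lia.
have := hm _ K1; rewrite /moment_condition.
set s := ereal_sup _ => soo.
have hs n x : window_index n -> window S n 1%g x ->
    ('E_Pr[(fun w => Num.max `|xi x (in_window S X n w)| 1 `^ (K.*2)%:R)%R] <=
      s)%E.
  move=> hn hx; apply: le_trans (_ : (ereal_sup _ <= s)%E); last first.
    by apply: ereal_sup_ubound; exists n.
  by apply: ereal_sup_ubound; exists x.
move: soo hs; case: s => [r| |] // _ hs.
  exists `|r|; split=> // _ n x hn hx.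
  by apply: le_trans (hs n x hn hx) _; rewrite lee_fin ler_norm.
exists 0; split=> // _ n x hn hx.
by apply: le_trans (hs n x hn hx) _; rewrite leNye.
Qed.

Lemma tail_bound : exp_quasi_local S X xi ->
  exists D delta a : R, [/\ 0 < D, 0 < delta, 0 < a &
    forall n x u, window_index n -> window S n 1%g x -> 0 <= u ->
    (Pr [set w | (u%:E <= stab_radius S xi x (in_window S X n w))%E]
      <= (D * expR (- (delta * u `^ a)))%:E)%E].
Proof.
case=> A [psi [A0 mono _ hP [a a0 ha]]].
have [D [delta [D0 delta0 hD]]] := stretched_expE a0 mono ha.
exists (A * D), delta, a; split; [exact: mulr_gt0|by []|by []|].
move=> n x u hn hx u0.
apply: (@le_trans _ _ (A * psi u)%:E); last first.
  by rewrite lee_fin -mulrA ler_wpM2l ?hD// ltW.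
apply: le_trans (hP u u0); apply: le_trans (_ : (ereal_sup _ <= _)%E);
  last first.
  by apply: ereal_sup_ubound; exists n.
by apply: ereal_sup_ubound; exists x.
Qed.

Lemma growth_bound : exp_growth S xi ->
  exists kappa c : R, [/\ 0 <= kappa, 0 <= c & forall t, (1 <= t)%N ->
    forall mu, `|xi 1%g (mu `&` window S (t%:R%:E : \bar R) 1%g)|
      <= expR (c * t%:R `^ kappa)].
Proof.
case=> kappa k0 [c hc]; exists kappa, `|c|; split=> // t t1 mu.
apply: le_trans (hc _ _ _) _; first by rewrite ltr0n.
by rewrite ler_expR ler_wpM2r ?powR_ge0 ?ler_norm.
Qed.

Section estimates.
Variables (C c : nat -> R) (phi : R -> R).
Hypotheses (hphi : fast_decreasing phi) (hcl : clustering_with S X C c phi).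
Variables (c0 Dp deltap b DC : R).
Hypotheses (c0_gt0 : 0 < c0) (c0_le : forall k, c0 <= c k).
Hypotheses (Dp_gt0 : 0 < Dp) (deltap_gt0 : 0 < deltap) (b_gt0 : 0 < b).
Hypothesis phi_le : forall u, 0 <= u -> phi u <= Dp * expR (- (deltap * u `^
  b)).
Hypotheses (DC_gt0 : 0 < DC)
  (C_le : forall k, (1 <= k)%N -> C k <= DC * expR (k%:R ^+ 2)).
Variables (Dw a : R).
Hypotheses (Dw_gt0 : 0 < Dw) (a_gt0 : 0 < a).
Hypothesis ball_le : forall t, (1 <= t)%N ->
  (size (ball_seq S t 1%g))%:R <= Dw * t%:R `^ a.
Variables (kappa cg : R).
Hypotheses (kappa_ge0 : 0 <= kappa) (cg_ge0 : 0 <= cg).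
Hypothesis growth : forall t, (1 <= t)%N -> forall mu,
  `|xi 1%g (mu `&` window S (t%:R%:E : \bar R) 1%g)| <= expR (cg * t%:R `^
    kappa).
Variables (Dt deltat at_ : R).
Hypotheses (Dt_gt0 : 0 < Dt) (deltat_gt0 : 0 < deltat) (at_gt0 : 0 < at_).
Hypothesis tail : forall n x u, window_index n -> window S n 1%g x -> 0 <= u ->
  (Pr [set w | (u%:E <= stab_radius S xi x (in_window S X n w))%E]
    <= (Dt * expR (- (deltat * u `^ at_)))%:E)%E.
Variable Mom : nat -> R.
Hypothesis Mom_ge0 : forall K, 0 <= Mom K.
Hypothesis moment : forall K, (1 <= K)%N -> forall n x, window_index n ->
  window S n 1%g x ->
  ('E_Pr[(fun w => Num.max `|xi x (in_window S X n w)| 1 `^ (K.*2)%:R)%R]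
    <= (Mom K)%:E)%E.

(** t^e dominates both t^kappa from the growth of scores and (t^a)^2 from N^2. Then gamma <= b /
    (2e) gives t^e <= s^(b/2), while gamma <= 1/2 keeps 4t <= s. *)
Let e := kappa + 2 * a.
Let gamma := Num.min (1 / 2) (b / (2 * e)).
Let beta := Num.min (gamma * at_) b.
(** The factor c0 / 2 combines c_N >= c0 with s - 2t >= s / 2. In [eta], half of [deltat] is lost to
    the square root of the tail and half of [delta3] to completing the square. In [H], the
    coefficient 3 collects 2 N^2 from 3^N and N^2 from C_N. *)
Let delta3 := deltap * (c0 / 2) `^ b.
Let eta := Num.min (deltat / 2) (delta3 / 2).
Let H (K : nat) : R := K%:R * cg + 3 * (K%:R * Dw) ^+ 2.
Let decay (s : R) := expR (- (eta * s `^ beta)).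

Let e_gt0 : 0 < e. Proof. by rewrite ltr_wpDl// mulr_gt0. Qed.
Let gamma_gt0 : 0 < gamma. Proof. by rewrite lt_min !divr_gt0// mulr_gt0. Qed.
Let gamma_le : gamma <= 1 / 2. Proof. by rewrite ge_min lexx. Qed.
Let beta_gt0 : 0 < beta. Proof. by rewrite lt_min mulr_gt0//=. Qed.
Let delta3_gt0 : 0 < delta3. Proof. by rewrite mulr_gt0// powR_gt0// divr_gt0.
  Qed.
Let eta_gt0 : 0 < eta. Proof. by rewrite lt_min !divr_gt0. Qed.

Let nat_ge1 (s : nat) : (16 <= s)%N -> 1 <= s%:R :> R.
Proof. by move=> s16; rewrite ler1n (leq_trans _ s16). Qed.

Lemma decay_tail s : (16 <= s)%N -> let t := Num.trunc (s%:R `^ gamma) in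
  is_true (expR (- (deltat / 2 * t.+1%:R `^ at_)) <= decay s%:R).
Proof.
move=> s16 t; have [_ _ _ ht] := stretched_radius gamma_gt0 gamma_le s16.
rewrite ler_expR lerN2; apply: ler_pM; rewrite ?powR_ge0 ?(ltW eta_gt0)//.
  by rewrite ge_min lexx.
apply: (@le_trans _ _ (s%:R `^ (gamma * at_))).
  by apply: ler_powR; [exact: nat_ge1|rewrite ge_min lexx].
by rewrite powRrM; apply: powR_le_base; rewrite ?powR_ge0// ltW.
Qed.

Lemma covariance_tail (s K : nat) : (16 <= s)%N -> (1 <= K)%N ->
  let t := Num.trunc (s%:R `^ gamma) in
  let N := (K * size (ball_seq S t 1%g))%N in
  is_true (3 ^+ N * expR (cg * t%:R `^ kappa) ^+ K *
    (C N * phi (c N * (s - t.*2)%:R)) <=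
  DC * Dp * expR (H K ^+ 2 / (2 * delta3)) * decay s%:R).
Proof.
move=> s16 K1 t N; have [t0 t4 ts _] := stretched_radius gamma_gt0 gamma_le s16.
rewrite -/t in t0 t4 ts.
have [phi01 phimono _] := hphi; have [C0 _ _ _ _] := hcl.
have s1 := nat_ge1 s16.
have t1 : 1 <= t%:R :> R by rewrite ler1n.
have N1 : (1 <= N)%N.
  rewrite muln_gt0 K1 /= lt0n; apply/negP => /eqP/size0nil E.
  have : 1%g \in ball_seq S t 1%g.
    rewrite mem_ball_seq//; apply: leq_trans (leq0n _).
    exact: (dist_le_size (s := [::])).
  by rewrite E.
(* In this variable the costs are at most exp(H v) and the clustering gain is exp(-delta3 v^2), as
   [expR_square] requires. *)
set v := s%:R `^ (b / 2).
have te : t%:R `^ e <= v.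
  apply: (@le_trans _ _ (s%:R `^ (gamma * e))).
    by rewrite powRrM; apply: powR_le_base => //; rewrite ltW.
  apply: ler_powR => //; apply: (@le_trans _ _ (b / (2 * e) * e)).
    by rewrite ler_wpM2r ?(ltW e_gt0)// ge_min lexx orbT.
  by rewrite le_eqVlt; apply/orP; left; apply/eqP; field; rewrite gt_eqF.
have NR : N%:R ^+ 2 <= (K%:R * Dw) ^+ 2 * v :> R.
  apply: (@le_trans _ _ ((K%:R * Dw * t%:R `^ a) ^+ 2)).
    apply: lerXn2r; rewrite ?nnegrE ?mulr_ge0 ?powR_ge0 ?(ltW Dw_gt0)//.
    by rewrite natrM -mulrA ler_wpM2l// ball_le.
  rewrite exprMn ler_wpM2l ?sqr_ge0//; apply: le_trans te.
  rewrite -powR_mulrn ?powR_ge0// -powRrM; apply: ler_powR => //.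
  by rewrite /e mulrC lerDr.
(* 3 <= 1 + 2 <= e^2 and N <= N^2. *)
have f1 : 3 ^+ N <= expR (2 * N%:R ^+ 2) :> R.
  apply: (@le_trans _ _ (expR 2 ^+ N)).
    apply: lerXn2r; rewrite ?nnegrE ?expR_ge0//.
    by apply: le_trans (expR_ge1Dx _); lra.
  by rewrite -expRM_natr ler_expR ler_wpM2l// expr2 -natrM ler_nat leq_pmull.
have f2 : expR (cg * t%:R `^ kappa) ^+ K <= expR (K%:R * cg * v).
  rewrite -expRM_natl ler_expR -mulrA ler_wpM2l// ler_wpM2l//.
  apply: le_trans te; apply: ler_powR => //; rewrite /e lerDl mulr_ge0// ltW//.
have f3 : C N <= DC * expR (N%:R ^+ 2) by exact: C_le.
have sb : v ^+ 2 = s%:R `^ b.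
  by rewrite -powR_mulrn ?powR_ge0// -powRrM divfK.
have f4 : phi (c N * (s - t.*2)%:R) <= Dp * expR (- (delta3 * v ^+ 2)).
  have c00 : 0 <= c0 / 2 by rewrite divr_ge0// ltW.
  have h : c0 / 2 * s%:R <= c N * (s - t.*2)%:R.
    rewrite -mulrA; apply: ler_pM; rewrite ?(ltW c0_gt0) ?mulr_ge0 ?invr_ge0//.
    by rewrite mulrC ler_pdivrMr// -natrM ler_nat (quarter_gap s16 t4).2.
  apply: le_trans (phimono _ _ _ h) _; first by rewrite mulr_ge0.
  apply: le_trans (phi_le _) _; first by rewrite mulr_ge0.
  by rewrite powRM// sb /delta3 mulrA.
have pphi : 0 <= phi (c N * (s - t.*2)%:R).
  have : 0 <= c N * (s - t.*2)%:R.
    by rewrite mulr_ge0//; apply: le_trans (c0_le N); exact: ltW.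
  by move/phi01/andP=> [].
apply: (@le_trans _ _ (expR (2 * N%:R ^+ 2) * expR (K%:R * cg * v) *
    ((DC * expR (N%:R ^+ 2)) * (Dp * expR (- (delta3 * v ^+ 2)))))).
  apply: ler_pM; [|exact: mulr_ge0 (ltW (C0 _)) pphi| |].
  - by rewrite mulr_ge0 ?exprn_ge0 ?expR_ge0.
  - by apply: ler_pM => //; rewrite ?exprn_ge0 ?expR_ge0.
  - by apply: ler_pM => //; exact: ltW.
rewrite (_ : _ * _ = DC * Dp * (expR (2 * N%:R ^+ 2) * expR (N%:R ^+ 2) *
  expR (K%:R * cg * v) * expR (- (delta3 * v ^+ 2)))); last by ring.
rewrite -[X in _ <= X]mulrA ler_wpM2l ?mulr_ge0 ?(ltW DC_gt0) ?(ltW Dp_gt0)//.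
apply: (@le_trans _ _ (expR (H K * v) * expR (- (delta3 * v ^+ 2)))).
  rewrite ler_wpM2r ?expR_ge0// -!expRD ler_expR /H.
  by exact: exponent_sum NR.
apply: le_trans (expR_square _ _ delta3_gt0) _.
rewrite ler_wpM2l ?expR_ge0// ler_expR lerN2 sb.
apply: ler_pM; rewrite ?powR_ge0 ?(ltW eta_gt0)//.
  by rewrite ge_min lexx orbT.
by apply: ler_powR => //; rewrite ge_min lexx orbT.
Qed.

Let B (K : nat) : R := K%:R * Mom K.
(** The first summand serves s < 16, where exp(eta 16^beta) cancels the decay. The second collects
    one truncation error for the joint moment and two for the product of moments; the third bounds
    the truncated covariance. *)
Let Cf (K : nat) : R :=
  (B K + B K ^+ 2) * expR (eta * 16 `^ beta) +
  ((1 + 2 * B K) * (K%:R * (Mom K + Dt)) +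
   DC * Dp * expR (H K ^+ 2 / (2 * delta3))).

Let B_ge0 K : 0 <= B K. Proof. by rewrite mulr_ge0. Qed.

Let Cf_gt0 K : 0 < Cf K.
Proof.
rewrite ltr_wpDl//; first by rewrite mulr_ge0 ?expR_ge0// addr_ge0// sqr_ge0.
rewrite ltr_wpDl//; last by rewrite !mulr_gt0// expR_gt0.
by rewrite mulr_ge0 ?addr_ge0 ?mulr_ge0 ?addr_ge0// ltW.
Qed.

Lemma quasi_local_clusters : mixed_moments_cluster S X xi decay.
Proof.
split; first exact: fast_decreasing_stretched.
exists Cf, (fun=> 1); split=> [K _|n p q z k hn p1 q1 zinj k1].
  by split; [exact: Cf_gt0|exact: ltr01].
set K := (\sum_(i < p + q) k i)%N.
set s := setdist S (range (z \o lshift q)) (range (z \o @rshift p q)).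
have KE : K = (\sum_(i < p) (k \o lshift q) i + \sum_(i < q) (k \o @rshift p q)
  i)%N.
  by rewrite /K big_split_ord.
have K1 : (1 <= K)%N.
  apply: (@leq_trans (p + q)); first by rewrite addn_gt0 p1.
  by rewrite -[X in (X <= _)%N](card_ord (p + q)) -sum1_card leq_sum.
(* For s < 16 any positive radius will do, since only the moment bounds are used there. *)
pose t := if (s < 16)%N then 1%N else Num.trunc (s%:R `^ gamma : R).
have t0 : (0 < t)%N.
  rewrite /t; case: (ltnP s 16) => // s16.
  by have [] := stretched_radius gamma_gt0 gamma_le s16.
(* The tail bound is [Dt] times eps squared, so eps Mom + eps^-1 tau becomes (Mom + Dt) eps. *)
pose eps := expR (- (deltat / 2 * t.+1%:R `^ at_)).
have eps0 : 0 < eps by exact: expR_gt0.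
pose tau := Dt * (eps * eps).
have tau0 : 0 <= tau by rewrite !mulr_ge0// ltW.
have htau x : window S n 1%g x ->
    (Pr [set w | (t.+1%:R%:E <= stab_radius S xi x (in_window S X n w))%E] <=
      tau%:E)%E.
  move=> hx; apply: le_trans (tail hn hx (ler0n R t.+1)) _; rewrite lee_fin.
  by rewrite ler_wpM2l ?(ltW Dt_gt0)// /eps -expRD ler_expR; lra.
have approx m (z' : 'I_m -> V) k' : (1 <= m)%N -> (forall i, (1 <= k' i)%N) ->
  (\sum_(i < m) k' i <= K)%N -> _ := fun m1 k1 kK =>
  @stable_approx _ _ _ _ _ _ X _ hS hxi n t m z' k' K eps (Mom K) tau m1 k1 kK
    eps0 (Mom_ge0 K) tau0 t0
    (fun x => @moment K K1 n x hn) htau.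
have kl i : (1 <= (k \o lshift q) i)%N by exact: k1.
have kr i : (1 <= (k \o @rshift p q) i)%N by exact: k1.
have kl' : (\sum_(i < p) (k \o lshift q) i <= K)%N by rewrite KE leq_addr.
have kr' : (\sum_(i < q) (k \o @rshift p q) i <= K)%N by rewrite KE leq_addl.
have [i1 b1 b1' d1] := approx _ z k (leq_trans p1 (leq_addr q p)) k1 (leqnn _).
have [i2 b2 b2' d2] := approx _ (z \o lshift q) _ p1 kl kl'.
have [i3 b3 b3' d3] := approx _ (z \o @rshift p q) _ q1 kr kr'.
rewrite /= /mixed_moment !expectation_mean//.
rewrite -/(sprod S X xi n z k) -/(sprod S X xi n (z \o lshift q) (k \o lshift
  q)).
rewrite -/(sprod S X xi n (z \o @rshift p q) (k \o @rshift p q)) -EFinM -EFinB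
  abse_EFin lee_fin.
have eT : K%:R * (eps * Mom K + eps^-1 * tau) = K%:R * (Mom K + Dt) * eps.
  by rewrite /tau; field; rewrite gt_eqF.
rewrite eT in d1 d2 d3.
rewrite mul1r -/s.
move: b1 b1' d1 b2 b2' d2 b3 b3' d3; rewrite -/(B K).
set f := mean _ _; set f' := mean _ _; set g := mean _ _; set g' := mean _ _.
set h := mean _ _; set h' := mean _ _ => b1 b1' d1 b2 b2' d2 b3 b3' d3.
have D0 : 0 <= decay s%:R by exact: expR_ge0.
have KMD : 0 <= K%:R * (Mom K + Dt) by rewrite mulr_ge0// addr_ge0// ltW.
have P1 : 0 <= (1 + 2 * B K) * (K%:R * (Mom K + Dt)).
  by rewrite mulr_ge0// addr_ge0// mulr_ge0.
have P2 : 0 <= DC * Dp * expR (H K ^+ 2 / (2 * delta3)).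
  by rewrite !mulr_ge0 ?expR_ge0// ltW.
have P3 : 0 <= B K + B K ^+ 2 by rewrite addr_ge0// sqr_ge0.
have [s16|s16] := ltnP s 16.
  rewrite /Cf mulrDl; apply: ler_wpDr; first by rewrite mulr_ge0// addr_ge0.
  rewrite -mulrA -expRD; apply: (@le_trans _ _ ((B K + B K ^+ 2) * 1)).
    rewrite mulr1 (le_trans (ler_normB _ _))// lerD// normrM expr2.
    by apply: ler_pM.
  rewrite ler_wpM2l// -[X in X <= _]expR0 ler_expR subr_ge0 ler_wpM2l ?(ltW
    eta_gt0)//.
  by apply: powR_le_base; rewrite ?(ltW beta_gt0)// ler_nat ltnW.
have hte : eps <= decay s%:R.
  by rewrite /eps /t ltnNge s16 /=; exact: decay_tail.
have hcov : `|f' - g' * h'| <= DC * Dp * expR (H K ^+ 2 / (2 * delta3)) * decay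
  s%:R.
  have tE : t = Num.trunc (s%:R `^ gamma : R) by rewrite /t ltnNge s16.
  have ht4 : (4 * t <= s)%N.
    rewrite tE.
    by have [] := stretched_radius gamma_gt0 gamma_le s16.
  have := tprod_cov hS hxi n hphi hcl (z := z) (trunc_score_le hxi (growth t0))
    k1.
  rewrite -/K -/s => /(_ _)/le_trans; rewrite tE => hh;
    apply: le_trans (covariance_tail s16 K1).
  rewrite -tE; rewrite -tE in hh.
  rewrite (_ : f' - g' * h' = cov Pr X (tprod S xi t n (z \o lshift q) (k \o
    lshift q))
    (tprod S xi t n (z \o @rshift p q) (k \o @rshift p q))).
    by apply: hh => //; exact: (quarter_gap s16 ht4).1.
  rewrite /cov; congr (mean _ _ - _); apply/funext => w; exact: tprod_split.
(* Primes mark truncated means. The product error is split as g' (h' - h) + h (g' - g), so that each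
   factor is bounded by [B K]. *)
apply: (@le_trans _ _ (`|f - f'| + `|f' - g' * h'| + (`|g'| * `|h' - h| + `|h|
  * `|g' - g|))).
  rewrite -!normrM.
  have -> : f - g * h = (f - f') + (f' - g' * h') + (g' * (h' - h) + h * (g' -
    g)).
    by ring.
  by rewrite (le_trans (ler_normD _ _))// lerD// (le_trans (ler_normD _ _))//
    lerD.
rewrite (distrC h' h) (distrC g' g).
have E1 : K%:R * (Mom K + Dt) * eps <= K%:R * (Mom K + Dt) * decay s%:R.
  by rewrite ler_wpM2l.
have E2 : `|g'| * `|h - h'| <= B K * (K%:R * (Mom K + Dt) * decay s%:R).
  exact: ler_pM (normr_ge0 _) (normr_ge0 _) b2' (le_trans d3 E1).
have E3 : `|h| * `|g - g'| <= B K * (K%:R * (Mom K + Dt) * decay s%:R).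
  exact: ler_pM (normr_ge0 _) (normr_ge0 _) b3 (le_trans d2 E1).
have E4 := le_trans d1 E1.
have E5 : 0 <= (B K + B K ^+ 2) * expR (eta * 16 `^ beta) * decay s%:R.
  by rewrite !mulr_ge0 ?expR_ge0.
exact: error_sum E4 hcov E2 E3 E5.
Qed.

End estimates.

Lemma condition2_clusters : condition2 S X xi ->
  exists phi, mixed_moments_cluster S X xi phi.
Proof.
case=> /poly_growth_ball [Dw [a [Dw0 a0 hball]]]
  [_ _ [phi [C [c [hphi hcl [c0 c00 hc0] [aC [aC0 aC1 hC]] [b b0 hb]]]]]]
  /tail_bound [Dt [deltat [at_ [Dt0 deltat0 at0 htail]]]]
  /growth_bound [kappa [cg [kappa0 cg0 hg]]] /moment_bound [Mom hMom].
have [_ phimono _] := hphi.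
have [Dp [deltap [Dp0 deltap0 hphile]]] := stretched_expE b0 phimono hb.
have [k k1|DC DC0 hDC] := bigO_ge1 hC; first exact: (powR_self_le_expR aC0 aC1
  k1).1.
have C_le k : (1 <= k)%N -> C k <= DC * expR (k%:R ^+ 2).
  move=> k1; apply: le_trans (hDC k k1) _; rewrite ler_wpM2l ?(ltW DC0)//.
  exact: (powR_self_le_expR aC0 aC1 k1).2.
eexists; exact: (quasi_local_clusters hphi hcl c00 hc0 Dp0 deltap0 b0 hphile
  DC0 C_le
  Dw0 a0 hball kappa0 cg0 hg Dt0 deltat0 at0 htail (fun K => (hMom K).1)
  (fun K => (hMom K).2)).
Qed.

End quasi_local_score.

Theorem theorem1p7 (R : realType) (V : groupType) (S : set V)
    (d : measure_display) (Omega : measurableType d) (Pr : probability Omega R)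
    (X : {RV Pr >-> spins V}) (xi : V -> set V -> R) (phi : R -> R) :
  cayley_data S ->
  score_function xi ->
  condition1 S X xi phi \/ condition2 S X xi ->
  exists phi' : R -> R,
    mixed_moments_cluster S X xi phi' /\
    (condition1 S X xi phi -> summable_in S phi -> summable_in S phi').
Proof.
(* The split is on whether condition 1 holds, not on which disjunct was given: both may hold, and
   then the witness must also be summable. When condition 1 fails, the summability clause is
   vacuous. *)
move=> hS hxi h12; have [h1|n1] := pselect (condition1 S X xi phi).
  exists (truncated_at_one phi); split; first exact: condition1_clusters h1.
  by have [_ [_ _ hphi _] _] := h1 => _; exact: summable_truncated.
have [phi' hphi'] : exists phi', mixed_moments_cluster S X xi phi'.
  by case: h12 => // /(condition2_clusters hS hxi).
by exists phi'.
Qed.
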